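(* Assume in addition that there is a constant $C_H>0$ such that $|H_i(\xi,p)-H_i(\xi,q)|\le C_H|p-q|$ for all $\xi\in\mathbb{R}^n$, $p,q\in\mathbb{R}^n$, $i=1,2$. For each $T>0$ there exists $C=C(T)>0$, independent of $\varepsilon$, such that for every $\varepsilon>0$ $$\|u_i^\varepsilon-m_i^\varepsilon\|_{L^\infty(\mathbb{R}^n\times[0,T])}\le C\varepsilon^{1/3}\qquad\text{for } i=1,2,$$ where $(u_1^\varepsilon,u_2^\varepsilon)$ is the viscosity solution of $$(u^\varepsilon_{1})_t + H_{1}\big(\tfrac{x}{\varepsilon},Du^\varepsilon_{1}\big)+\tfrac{1}{\varepsilon}(u^\varepsilon_{1}-u^\varepsilon_{2})=0,\qquad (u^\varepsilon_{2})_t + H_{2}\big(\tfrac{x}{\varepsilon},Du^\varepsilon_{2}\big)+\tfrac{1}{\varepsilon}(u^\varepsilon_{2}-u^\varepsilon_{1})=0\quad\text{in }\mathbb{R}^n\times(0,T),$$ with $u_i^\varepsilon(\cdot,0)=f_i$ on $\mathbb{R}^n$ for $i=1,2$, $$m_i^\varepsilon(x,t):=u(x,t)+\frac{(f_i-f_j)(x)}{2}\,e^{-2t/\varepsilon},\qquad \{i,j\}=\{1,2\},$$ and $u$ is the viscosity solution of $u_t+\overline{H}(Du)=0$ in $\mathbb{R}^n\times(0,T)$, $u(\cdot,0)=\frac{f_1+f_2}{2}$ on $\mathbb{R}^n$.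
   Context: The Hamiltonians $H_1,H_2:\mathbb{R}^n\times\mathbb{R}^n\to\mathbb{R}$, $(\xi,p)\mapsto H_i(\xi,p)$, are continuous, satisfy the coercivity condition $\lim_{r\to\infty}\inf\{H_i(\xi,p):\xi\in\mathbb{R}^n,\ |p|\ge r\}=\infty$, and are periodic in $\xi$: $H_i(\xi+z,p)=H_i(\xi,p)$ for all $\xi,p\in\mathbb{R}^n$, $z\in\mathbb{Z}^n$. The initial data $f_1,f_2\in C^1(\mathbb{R}^n)$ have bounded gradients, $\|Df_i\|_{L^\infty(\mathbb{R}^n)}<\infty$. All solutions of equations and systems are viscosity solutions (for a system, the viscosity inequality is imposed on each component with the other component inserted as a given function); the comparison principle for these problems is taken as known, and ''the solution'' is the unique viscosity solution it provides. Effective Hamiltonian: for each $P\in\mathbb{R}^n$ it is known that there is a unique constant $\overline{H}(P)$ such that the cell problem $$H_1(\xi,P+Dv_1(\xi))+v_1(\xi)-v_2(\xi)=\overline{H}(P),\qquad H_2(\xi,P+Dv_2(\xi))+v_2(\xi)-v_1(\xi)=\overline{H}(P)\quad\text{in }\mathbb{R}^n$$ admits a $\mathbb{Z}^n$-periodic continuous viscosity solution $(v_1,v_2)$. *)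

(* Defs.v *)
From mathcomp Require Import all_boot all_order all_algebra.
From mathcomp Require Import all_classical all_reals all_analysis.

Set Implicit Arguments.
Unset Strict Implicit.
Unset Printing Implicit Defensive.

Import Order.TTheory GRing.Theory Num.Theory.
Import numFieldNormedType.Exports.

Local Open Scope classical_set_scope.
Local Open Scope ring_scope.

(* The library norm on 'rV[R]_n is the sup norm, hence a separate Euclidean
   norm. *)
Definition enorm (R : realType) (n : nat) (p : 'rV[R]_n) : R :=
  Num.sqrt (\sum_(i < n) p 0 i ^+ 2).

(* For continuous functions on [A], where [A] is the closure of its interior,
   this supremum is the L^oo norm. *)
Definition sup_norm (R : realType) (T : Type) (A : set T) (g : T -> R) : \bar R :=
  ereal_sup [set `|g z|%:E | z in A].

(* Intended for open [O] in a finite-dimensional [V]. *)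
Definition C1_on (R : realType) (V : normedModType R) (O : set V)
    (phi : V -> R) : Prop :=
  forall z, O z ->
    differentiable phi z /\ forall v, {for z, continuous (fun w => 'D_v phi w)}.

Definition grad (R : realType) (n : nat) (f : 'rV[R]_n -> R) (x : 'rV[R]_n) :
    'rV[R]_n :=
  \row_(i < n) 'D_(delta_mx 0 i) f x.

Definition Zperiodic (R : realType) (n : nat) (v : 'rV[R]_n -> R) : Prop :=
  forall (xi : 'rV[R]_n) (k : 'rV[int]_n), v (xi + map_mx intr k) = v xi.

Definition coercive (R : realType) (n : nat)
    (H : 'rV[R]_n -> 'rV[R]_n -> R) : Prop :=
  ereal_inf [set y : \bar R | exists xi p, r <= enorm p /\ y = (H xi p)%:E]
    @[r --> +oo%R] --> +oo%E.

Definition hamiltonian (R : realType) (n : nat)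
    (H : 'rV[R]_n -> 'rV[R]_n -> R) : Prop :=
  [/\ continuous (fun z : 'rV[R]_n * 'rV[R]_n => H z.1 z.2),
      coercive H
    & forall p, Zperiodic (fun xi => H xi p)].

Definition initial_datum (R : realType) (n : nat) (f : 'rV[R]_n -> R) : Prop :=
  C1_on setT f /\ (sup_norm setT (fun x => enorm (grad f x)) < +oo)%E.

(* Viscosity solutions in the open set [O] of F(z, u(z), Du(z)) = 0.  The
   derivative is passed to [F] as the function sending a direction [v] to the
   directional derivative along [v]. *)
Definition visc_subsolution (R : realType) (V : normedModType R) (O : set V)
    (F : V -> R -> (V -> R) -> R) (u : V -> R) : Prop :=
  forall (phi : V -> R) (z0 : V), C1_on O phi -> O z0 ->
    (\forall z \near z0, u z - phi z <= u z0 - phi z0) ->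
    F z0 (u z0) (fun v => 'D_v phi z0) <= 0.

Definition visc_supersolution (R : realType) (V : normedModType R) (O : set V)
    (F : V -> R -> (V -> R) -> R) (u : V -> R) : Prop :=
  forall (phi : V -> R) (z0 : V), C1_on O phi -> O z0 ->
    (\forall z \near z0, u z0 - phi z0 <= u z - phi z) ->
    0 <= F z0 (u z0) (fun v => 'D_v phi z0).

Definition visc_solution (R : realType) (V : normedModType R) (O : set V)
    (F : V -> R -> (V -> R) -> R) (u : V -> R) : Prop :=
  visc_subsolution O F u /\ visc_supersolution O F u.

(* H(xi, P + Dv) + v - w = c, with [w] a given function. *)
Definition cell_eq (R : realType) (n : nat) (H : 'rV[R]_n -> 'rV[R]_n -> R)
    (P : 'rV[R]_n) (c : R) (w : 'rV[R]_n -> R)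
    (xi : 'rV[R]_n) (r : R) (d : 'rV[R]_n -> R) : R :=
  H xi (P + \row_(i < n) d (delta_mx 0 i)) + r - w xi - c.

Definition cell_solvable (R : realType) (n : nat)
    (H1 H2 : 'rV[R]_n -> 'rV[R]_n -> R) (P : 'rV[R]_n) (c : R) : Prop :=
  exists v1 v2 : 'rV[R]_n -> R,
    [/\ continuous v1 /\ continuous v2,
        Zperiodic v1 /\ Zperiodic v2,
        visc_solution setT (cell_eq H1 P c v2) v1
      & visc_solution setT (cell_eq H2 P c v1) v2].

Definition effective_hamiltonian (R : realType) (n : nat)
    (H1 H2 : 'rV[R]_n -> 'rV[R]_n -> R) (Hbar : 'rV[R]_n -> R) : Prop :=
  forall (P : 'rV[R]_n) (c : R), cell_solvable H1 H2 P c <-> c = Hbar P.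

(* Space-time points are pairs (x, t). *)
Definition time_deriv (R : realType) (n : nat) (d : 'rV[R]_n * R -> R) : R :=
  d (0, 1).

Definition space_grad (R : realType) (n : nat) (d : 'rV[R]_n * R -> R) :
    'rV[R]_n :=
  \row_(i < n) d (delta_mx 0 i, 0).

Definition open_strip (R : realType) (n : nat) (T : R) : set ('rV[R]_n * R) :=
  [set z | 0 < z.2 < T].

Definition closed_strip (R : realType) (n : nat) (T : R) : set ('rV[R]_n * R) :=
  [set z | 0 <= z.2 <= T].

(* u_t + H(x/eps, Du) + (u - w)/eps = 0, with [w] a given function. *)
Definition system_eq (R : realType) (n : nat) (H : 'rV[R]_n -> 'rV[R]_n -> R)
    (eps : R) (w : 'rV[R]_n * R -> R)
    (z : 'rV[R]_n * R) (r : R) (d : 'rV[R]_n * R -> R) : R :=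
  time_deriv d + H (eps^-1 *: z.1) (space_grad d) + eps^-1 * (r - w z).

Definition effective_eq (R : realType) (n : nat) (Hbar : 'rV[R]_n -> R)
    (z : 'rV[R]_n * R) (r : R) (d : 'rV[R]_n * R -> R) : R :=
  time_deriv d + Hbar (space_grad d).

Definition solves_system (R : realType) (n : nat)
    (H1 H2 : 'rV[R]_n -> 'rV[R]_n -> R) (f1 f2 : 'rV[R]_n -> R) (T eps : R)
    (u1 u2 : 'rV[R]_n * R -> R) : Prop :=
  [/\ {within closed_strip T, continuous u1} /\
      {within closed_strip T, continuous u2},
      visc_solution (open_strip T) (system_eq H1 eps u2) u1,
      visc_solution (open_strip T) (system_eq H2 eps u1) u2
    & forall x, u1 (x, 0) = f1 x /\ u2 (x, 0) = f2 x].

Definition solves_effective (R : realType) (n : nat) (Hbar : 'rV[R]_n -> R)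
    (f1 f2 : 'rV[R]_n -> R) (T : R) (u : 'rV[R]_n * R -> R) : Prop :=
  [/\ {within closed_strip T, continuous u},
      visc_solution (open_strip T) (effective_eq Hbar) u
    & forall x, u (x, 0) = (f1 x + f2 x) / 2].

Definition m_eps (R : realType) (n : nat) (u : 'rV[R]_n * R -> R)
    (fi fj : 'rV[R]_n -> R) (eps : R) (z : 'rV[R]_n * R) : R :=
  u z + (fi z.1 - fj z.1) / 2 * expR (- 2 * z.2 / eps).

(* Main.v *)
Require Import Defs.
From HB Require Import structures.
From mathcomp Require Import all_boot all_order all_algebra.
From mathcomp Require Import all_classical all_reals all_analysis.
From mathcomp Require Import ring lra.

Set Implicit Arguments.
Unset Strict Implicit.
Unset Printing Implicit Defensive.

Import Order.TTheory GRing.Theory Num.Theory.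
Import numFieldNormedType.Exports.

Local Open Scope classical_set_scope.
Local Open Scope ring_scope.

(* Subtracting from u_i^eps the explicit layer
   (f_i - f_j)/2 e^(-2t/eps) + O(min(t, eps)) leaves, by the Lipschitz bound on
   the Hamiltonians, a subsolution of the same system with the common initial
   datum g = (f_1 + f_2)/2, so it remains to compare it with u.

   No dependence of the correctors on P is used.  At a maximum point
   (x0, t0, y0, s0) of the functional doubling the variables, with a space
   penalisation of slope at most K, put p0 = its slope, so that |p0| <= K.
   On [t0 - tau, t0] the subsolution is compared with
   p0.x - Hbar(p0) t + eps v(x/eps; p0) plus a term that moves at the finite
   propagation speed C_H; this costs eps + tau^2/delta, where delta is the
   doubling parameter, and the equation for u at (y0, s0) converts it into an
   error eps/tau + tau/delta in the time slope.  The total error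
   delta + tau + eps/tau + tau/delta is O(eps^(1/3)) for delta = eps^(1/3) and
   tau = eps^(2/3).

   The lower bound is the upper bound for -H_i(xi, -p), -f_i and -u_i. *)

(** * Euclidean norm *)

(** For each slope the cell problem only provides some corrector, so nothing controls how a choice
    varies with the slope; a perturbed test function whose slope moves with the point would need
    such control. Freezing [p0] leaves test functions whose slope differs from [p0] away from the
    maximum point.

    No Lipschitz estimate in space is proved for u^eps or u. The penalisation grows linearly, so its
    slope is bounded whatever the solutions do, and growth bounds linear in time confine the
    maximum.

    Coercivity acts through the correctors: it gives the Hamiltonians a lower bound, which bounds
    the coupling, and then bounds the gradients, with constants uniform for slopes in a ball.

    The layer comes from dropping the Hamiltonians: the difference w of the two components then
    solves w' = - 2 w / eps. *)

Definition dot (R : realType) (n : nat) (p q : 'rV[R]_n) : R :=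
  \sum_(i < n) p 0 i * q 0 i.

Lemma dotC (R : realType) n (p q : 'rV[R]_n) : dot p q = dot q p.
Proof. by apply: eq_bigr => i _; rewrite mulrC. Qed.

Lemma dotDl (R : realType) n (p q r : 'rV[R]_n) :
  dot (p + q) r = dot p r + dot q r.
Proof. by rewrite -big_split; apply: eq_bigr => i _; rewrite mxE mulrDl. Qed.

Lemma dotZl (R : realType) n a (p q : 'rV[R]_n) : dot (a *: p) q = a * dot p q.
Proof. by rewrite mulr_sumr; apply: eq_bigr => i _; rewrite mxE mulrA. Qed.

Lemma dotNl (R : realType) n (p q : 'rV[R]_n) : dot (- p) q = - dot p q.
Proof. by rewrite -scaleN1r dotZl mulN1r. Qed.

Lemma dotDr (R : realType) n (p q r : 'rV[R]_n) :
  dot r (p + q) = dot r p + dot r q.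
Proof. by rewrite !(dotC r) dotDl. Qed.

Lemma dotZr (R : realType) n a (p q : 'rV[R]_n) : dot q (a *: p) = a * dot q p.
Proof. by rewrite !(dotC q) dotZl. Qed.

Lemma dotNr (R : realType) n (p q : 'rV[R]_n) : dot q (- p) = - dot q p.
Proof. by rewrite !(dotC q) dotNl. Qed.

Lemma dot_delta (R : realType) n (p : 'rV[R]_n) i : dot p (delta_mx 0 i) = p 0 i.
Proof.
rewrite /dot (bigD1 i)//= mxE !eqxx mulr1 big1 ?addr0// => j ji.
by rewrite mxE (negbTE ji) andbF mulr0.
Qed.

Lemma dot_ge0 (R : realType) n (p : 'rV[R]_n) : 0 <= dot p p.
Proof. by apply: sumr_ge0 => i _; rewrite -expr2 sqr_ge0. Qed.

Lemma enormE (R : realType) n (p : 'rV[R]_n) : enorm p = Num.sqrt (dot p p).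
Proof. by congr Num.sqrt; apply: eq_bigr => i _; rewrite expr2. Qed.

Lemma enorm_ge0 (R : realType) n (p : 'rV[R]_n) : 0 <= enorm p.
Proof. exact: sqrtr_ge0. Qed.

Lemma sqr_enorm (R : realType) n (p : 'rV[R]_n) : enorm p ^+ 2 = dot p p.
Proof. by rewrite enormE sqr_sqrtr ?dot_ge0. Qed.

Lemma dot_le (R : realType) n (p q : 'rV[R]_n) : dot p q <= enorm p * enorm q.
Proof.
(* With a = |q| and b = |p| the square is 2 |p| |q| (|p| |q| - p.q). The factor |p| |q| is divided
   out, hence the two degenerate cases. *)
have H a b : 0 <= a ^+ 2 * dot p p - 2 * a * b * dot p q + b ^+ 2 * dot q q.
  have -> : a ^+ 2 * dot p p - 2 * a * b * dot p q + b ^+ 2 * dot q q =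
      dot (a *: p - b *: q) (a *: p - b *: q); last exact: dot_ge0.
  by rewrite !(dotDl, dotDr, dotNl, dotNr, dotZl, dotZr) (dotC q p); ring.
have := H (enorm q) (enorm p); rewrite -!sqr_enorm => {}H.
have [p0|pN] := eqVneq (enorm p) 0.
  rewrite p0 mul0r; move: (p0) => /eqP; rewrite enormE sqrtr_eq0 => p1.
  have pi i : p 0 i = 0.
    have : dot p p == 0 by rewrite eq_le p1 dot_ge0.
    rewrite psumr_eq0; last by move=> j _; rewrite -expr2 sqr_ge0.
    by move/allP => /(_ i (mem_index_enum _)); rewrite /= mulf_eq0 orbb => /eqP.
  by rewrite /dot big1 // => i _; rewrite pi mul0r.
have [q0|qN] := eqVneq (enorm q) 0.
  rewrite q0 mulr0; move: (q0) => /eqP; rewrite enormE sqrtr_eq0 => p1.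
  have pi i : q 0 i = 0.
    have : dot q q == 0 by rewrite eq_le p1 dot_ge0.
    rewrite psumr_eq0; last by move=> j _; rewrite -expr2 sqr_ge0.
    by move/allP => /(_ i (mem_index_enum _)); rewrite /= mulf_eq0 orbb => /eqP.
  by rewrite /dot big1 // => i _; rewrite pi mulr0.
have P : 0 < enorm q * enorm p by rewrite mulr_gt0// lt_def ?pN ?qN enorm_ge0.
rewrite -(ler_pM2l P); nra.
Qed.

Lemma enormD (R : realType) n (p q : 'rV[R]_n) :
  enorm (p + q) <= enorm p + enorm q.
Proof.
have h := dot_le p q; have hp := enorm_ge0 p; have hq := enorm_ge0 q.
rewrite -(ler_pXn2r (n := 2))// ?nnegrE ?addr_ge0 ?enorm_ge0//.
by rewrite sqr_enorm !(dotDl, dotDr) (dotC q) -!sqr_enorm; nra.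
Qed.

Lemma enormZ (R : realType) n a (p : 'rV[R]_n) : enorm (a *: p) = `|a| * enorm p.
Proof.
by rewrite !enormE dotZl dotZr mulrA -expr2 sqrtrM ?sqr_ge0// sqrtr_sqr.
Qed.

Lemma enormN (R : realType) n (p : 'rV[R]_n) : enorm (- p) = enorm p.
Proof. by rewrite -scaleN1r enormZ normrN1 mul1r. Qed.

Lemma enormB (R : realType) n (p q : 'rV[R]_n) : enorm (p - q) = enorm (q - p).
Proof. by rewrite -opprB enormN. Qed.

Lemma enorm0 (R : realType) n : enorm (0 : 'rV[R]_n) = 0.
Proof. by rewrite -(scale0r 0) enormZ normr0 mul0r. Qed.

Lemma enorm_tri (R : realType) n (r p q : 'rV[R]_n) :
  enorm (p - q) <= enorm (p - r) + enorm (r - q).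
Proof. by rewrite -[p - q](subrKA r) enormD. Qed.

Lemma coord_le_enorm (R : realType) n (p : 'rV[R]_n) i : `|p 0 i| <= enorm p.
Proof.
rewrite -sqrtr_sqr; apply: ler_wsqrtr; rewrite (bigD1 i)//= lerDl.
by apply: sumr_ge0 => j _; exact: sqr_ge0.
Qed.

Lemma mx_norm_le_enorm (R : realType) n (p : 'rV[R]_n) : `|p| <= enorm p.
Proof.
rewrite /Num.norm/= mx_normrE; apply/bigmax_leP; split; first exact: enorm_ge0.
by move=> [i j] _ /=; rewrite (ord1 i) coord_le_enorm.
Qed.


Lemma continuous_enorm (R : realType) n (T : topologicalType)
    (f : T -> 'rV[R]_n) : continuous f -> continuous (fun x => enorm (f x)).
Proof.
move=> cf x; apply: (@continuous_comp _ _ _ _ Num.sqrt); last exact: sqrt_continuous.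
apply: cvg_big => [|i _]; first by move=> z; exact: add_continuous.
have h : {for x, continuous (fun y => f y 0 i)}.
  apply: (@continuous_comp _ _ _ f (fun y : 'rV[R]_n => y 0 i)); first exact: cf.
  exact: coord_continuous.
exact: (continuousM h h).
Qed.

Lemma continuous_dot (R : realType) n (T : topologicalType)
    (f g : T -> 'rV[R]_n) : continuous f -> continuous g ->
  continuous (fun x => dot (f x) (g x)).
Proof.
move=> cf cg x.
apply: cvg_big => [|i _]; first by move=> z; exact: add_continuous.
have h (k : T -> 'rV[R]_n) : continuous k -> {for x, continuous (fun y => k y 0 i)}.
  move=> ck.
  apply: (@continuous_comp _ _ _ k (fun y : 'rV[R]_n => y 0 i)); first exact: ck.
  exact: coord_continuous.
exact: (continuousM (h _ cf) (h _ cg)).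
Qed.

Lemma compact_eball (R : realType) n (a : 'rV[R]_n) r :
  compact [set x | enorm (x - a) <= r].
Proof.
apply: bounded_closed_compact.
  exists (r + enorm a); split; first exact: num_real.
  move=> M hM x /= hx; apply: (le_trans (mx_norm_le_enorm _)).
  rewrite -[x](subrK a); apply: (le_trans (enormD _ _)).
  by apply: le_trans (ltW hM); rewrite lerD2r.
have c : continuous (fun x : 'rV[R]_n => enorm (x - a)).
  apply: continuous_enorm => y.
  by apply: continuousB; [exact: cvg_id | exact: cst_continuous].
have := @preimage_closed _ _ (fun x : 'rV[R]_n => enorm (x - a)) [set y | y <= r].
by apply; [move=> x _; exact: c|exact: closed_le].
Qed.

(** * Continuously differentiable functions *)

(** The derivative is carried as explicit data, so that gradients of composite test functions come
    out of the calculus rules below. *)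
Definition isC1 (R : realType) (V : normedModType R) (f : V -> R)
    (df : V -> V -> R) : Prop :=
  (forall z, is_diff z f (df z)) /\ (forall v, continuous (fun z => df z v)).

Lemma isC1_derive (R : realType) (V : normedModType R) (f : V -> R) df :
  isC1 f df -> forall z v, 'D_v f z = df z v.
Proof. by move=> [h _] z v; rewrite deriveE ?diff_val. Qed.

Lemma isC1_C1_on (R : realType) (V : normedModType R) (f : V -> R) df (O : set V) :
  isC1 f df -> C1_on O f.
Proof.
move=> [h c] z _; split; first by have [] := h z.
move=> v; rewrite (_ : (fun w => 'D_v f w) = fun w => df w v); first exact: c.
by apply/funext => w; rewrite (@isC1_derive _ _ _ df).
Qed.

Lemma C1_on_isC1 (R : realType) (V : normedModType R) (f : V -> R) :
  C1_on setT f -> isC1 f (fun z v => 'D_v f z).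
Proof.
move=> h; split=> [z|v z]; last by have [//|_] := h z; apply.
have [//|d _] := h z; split=> //; apply/funext => v; by rewrite deriveE.
Qed.

Lemma isC1_eq (R : realType) (V : normedModType R) (f g : V -> R) df dg :
  isC1 f df -> f = g -> (forall z v, df z v = dg z v) -> isC1 g dg.
Proof.
move=> h <- e; have -> : dg = df; last by [].
by apply/funext => z; apply/funext => v; rewrite e.
Qed.

Lemma isC1_cst (R : realType) (V : normedModType R) (a : R) :
  isC1 (fun _ : V => a) (fun _ _ => 0).
Proof.
split=> [z|v]; last exact: cst_continuous.
exact: (is_diff_eq (is_diff_cst _ _)).
Qed.

Lemma isC1D (R : realType) (V : normedModType R) (f g : V -> R) df dg :
  isC1 f df -> isC1 g dg ->
  isC1 (fun z => f z + g z) (fun z v => df z v + dg z v).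
Proof.
move=> [h c] [k d]; split=> [z|v z]; first exact: (is_diffD (h z) (k z)).
by apply: continuousD; [exact: c|exact: d].
Qed.

Lemma isC1Z (R : realType) (V : normedModType R) (a : R) (f : V -> R) df :
  isC1 f df -> isC1 (fun z => a * f z) (fun z v => a * df z v).
Proof.
move=> [h c]; split=> [z|v z]; first exact: (is_diffZ a (h z)).
by apply: continuousM; [exact: cst_continuous|exact: c].
Qed.

Lemma isC1_continuous (R : realType) (V : normedModType R) (f : V -> R) df :
  isC1 f df -> continuous f.
Proof. by move=> [h _] z; apply: differentiable_continuous; have [] := h z. Qed.

Lemma isC1M (R : realType) (V : normedModType R) (f g : V -> R) df dg :
  isC1 f df -> isC1 g dg ->
  isC1 (fun z => f z * g z) (fun z v => f z * dg z v + g z * df z v).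
Proof.
move=> hf hg; have [h c] := hf; have [k d] := hg.
split=> [z|v z]; first exact: (is_diffM (h z) (k z)).
apply: cvgD; apply: cvgM; try exact: d; try exact: c.
  exact: (isC1_continuous hf).
exact: (isC1_continuous hg).
Qed.

Lemma isC1_comp (R : realType) (V : normedModType R) (h h' : R -> R) (f : V -> R) df :
  isC1 f df -> (forall z, is_derive (f z) 1 h (h' (f z))) ->
  continuous (fun z => h' (f z)) ->
  isC1 (fun z => h (f z)) (fun z v => h' (f z) * df z v).
Proof.
move=> hf hh ch; have [k c] := hf.
split=> [z|v z]; last by apply: continuousM; [exact: ch|exact: c].
have [dh vh] := hh z.
have dh' : differentiable h (f z) by exact/derivable1_diffP.
have : is_diff (f z) h (fun t => h' (f z) * t).
  split=> //; apply/funext => t.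
  by rewrite deriv1E// derive1E vh; rewrite /GRing.scale/= mulrC.
by move=> i; exact: (is_diff_comp (k z) i).
Qed.

Lemma is_diff_linear (R : realType) (V W : normedModType R) (f : V -> W) :
  linear f -> continuous f -> forall x, is_diff x f f.
Proof.
move=> lf cf x.
pose sM := GRing.isLinear.Build _ _ _ _ _ lf.
pose s : {linear V -> W} := HB.pack f sM.
have -> : f = s by [].
by split; [exact: linear_differentiable|rewrite diff_lin].
Qed.

Lemma isC1_fst (R : realType) (U V : normedModType R) (f : U -> R) df :
  isC1 f df -> isC1 (fun z : U * V => f z.1) (fun z v => df z.1 v.1).
Proof.
move=> [h c]; split=> [z|v z].
  have fz : is_diff z (fst : U * V -> U) fst.
    by apply: is_diff_linear => // y; exact: cvg_fst.
  exact: (is_diff_comp fz (h z.1)).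
apply: (@continuous_comp _ _ _ fst (fun x => df x v.1)); first exact: cvg_fst.
exact: c.
Qed.

Lemma isC1_snd (R : realType) (U V : normedModType R) (f : V -> R) df :
  isC1 f df -> isC1 (fun z : U * V => f z.2) (fun z v => df z.2 v.2).
Proof.
move=> [h c]; split=> [z|v z].
  have fz : is_diff z (snd : U * V -> V) snd.
    by apply: is_diff_linear => // y; exact: cvg_snd.
  exact: (is_diff_comp fz (h z.2)).
apply: (@continuous_comp _ _ _ snd (fun x => df x v.2)); first exact: cvg_snd.
exact: c.
Qed.

Lemma isC1_id (R : realType) : isC1 (fun t : R => t) (fun _ v => v).
Proof. by split=> [z|v]; [exact: is_diff_id|exact: cst_continuous]. Qed.

Lemma isC1_dot (R : realType) n (p : 'rV[R]_n) : isC1 (dot p) (fun _ v => dot p v).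
Proof.
split=> [z|v]; last exact: cst_continuous.
apply: is_diff_linear; last by apply: continuous_dot => x; [exact: cst_continuous|exact: cvg_id].
by move=> a u v; rewrite dotDr dotZr.
Qed.

Lemma isC1_sum (R : realType) (V : normedModType R) (I : finType)
    (f : I -> V -> R) df : (forall i, isC1 (f i) (df i)) ->
  isC1 (fun z => \sum_i f i z) (fun z v => \sum_i df i z v).
Proof.
move=> h; elim: (index_enum I) => [|i s IH].
  by apply: isC1_eq (isC1_cst V 0) _ _ => [|z v]; rewrite ?big_nil//;
    apply/funext => z; rewrite big_nil.
apply: isC1_eq (isC1D (h i) IH) _ _ => [|z v]; rewrite ?big_cons//.
by apply/funext => z; rewrite big_cons.
Qed.

Lemma isC1_sq (R : realType) n (a : 'rV[R]_n) :
  isC1 (fun x => dot (x - a) (x - a)) (fun x v => 2 * dot (x - a) v).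
Proof.
have h i : isC1 (fun x : 'rV[R]_n => (x - a) 0 i) (fun _ v => v 0 i).
  have := isC1D (isC1_dot (delta_mx 0 i)) (isC1_cst _ (- a 0 i)).
  move/isC1_eq; apply=> [|z v]; last by rewrite addr0 dotC dot_delta.
  by apply/funext => x; rewrite dotC dot_delta !mxE.
apply: isC1_eq (isC1_sum (fun i => isC1M (h i) (h i))) _ _ => // x v.
by rewrite mulr_sumr; apply: eq_bigr => i _; ring.
Qed.

(** For positive [s], a smooth substitute for the distance to [a]: it exceeds the distance by at
    most [s], its gradient [dang] has length at most 1, and its second derivatives are at most 1 /
    [s]. *)
Definition ang (R : realType) (n : nat) (s : R) (a x : 'rV[R]_n) : R :=
  Num.sqrt (s ^+ 2 + dot (x - a) (x - a)).

Lemma ang_gt0 (R : realType) n s (a x : 'rV[R]_n) : 0 < s -> 0 < ang s a x.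
Proof. by move=> s0; rewrite sqrtr_gt0 ltr_wpDr ?dot_ge0// exprn_gt0. Qed.

Lemma sqr_ang (R : realType) n s (a x : 'rV[R]_n) :
  ang s a x ^+ 2 = s ^+ 2 + dot (x - a) (x - a).
Proof. by rewrite sqr_sqrtr// addr_ge0 ?dot_ge0// sqr_ge0. Qed.

Lemma ang_ge (R : realType) n s (a x : 'rV[R]_n) : enorm (x - a) <= ang s a x.
Proof. by rewrite enormE; apply: ler_wsqrtr; rewrite lerDr sqr_ge0. Qed.

Lemma ang_ge_s (R : realType) n s (a x : 'rV[R]_n) : 0 <= s -> s <= ang s a x.
Proof.
move=> s0; rewrite -[X in X <= _](ger0_norm s0) -sqrtr_sqr.
by apply: ler_wsqrtr; rewrite lerDl dot_ge0.
Qed.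

Lemma ang_le (R : realType) n s (a x : 'rV[R]_n) : 0 <= s ->
  ang s a x <= s + enorm (x - a).
Proof.
move=> s0; rewrite -(ler_pXn2r (n := 2))// ?nnegrE ?sqrtr_ge0 ?addr_ge0 ?enorm_ge0//.
rewrite sqr_ang -sqr_enorm sqrrD; have := enorm_ge0 (x - a); nra.
Qed.

Lemma ang_center (R : realType) n s (a : 'rV[R]_n) : 0 <= s -> ang s a a = s.
Proof.
move=> s0; rewrite /ang subrr -sqr_enorm enorm0 expr0n addr0 sqrtr_sqr.
exact: ger0_norm.
Qed.

Definition dang (R : realType) (n : nat) (s : R) (a x : 'rV[R]_n) : 'rV[R]_n :=
  (ang s a x)^-1 *: (x - a).

Lemma isC1_ang (R : realType) n s (a : 'rV[R]_n) : 0 < s ->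
  isC1 (ang s a) (fun x v => dot (dang s a x) v).
Proof.
move=> s0.
have h := isC1D (isC1_cst _ (s ^+ 2)) (isC1_sq a).
have P (z : 'rV[R]_n) : 0 < s ^+ 2 + dot (z - a) (z - a).
  by rewrite ltr_wpDr ?dot_ge0// exprn_gt0.
have c : continuous (fun z : 'rV[R]_n => (2 * ang s a z)^-1).
  move=> z; apply: (@continuousV R 'rV[R]_n (fun w => 2 * ang s a w) z).
    by rewrite mulf_neq0// gt_eqF// ang_gt0.
  apply: continuousM; first exact: cst_continuous.
  apply: (@continuous_comp _ _ _ _ Num.sqrt); last exact: sqrt_continuous.
  exact: (isC1_continuous h).
have := @isC1_comp R _ Num.sqrt (fun y => (2 * Num.sqrt y)^-1) _ _ h
  (fun z => is_derive1_sqrt (P z)) c.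
move=> /isC1_eq; apply=> // x v.
rewrite /= add0r /dang dotZl -/(ang s a x) invfM mulrACA.
by rewrite mulVf ?pnatr_eq0// mul1r.
Qed.

Lemma enorm_dang (R : realType) n s (a x : 'rV[R]_n) : 0 < s ->
  enorm (dang s a x) <= 1.
Proof.
move=> s0; rewrite enormZ gtr0_norm ?invr_gt0 ?ang_gt0// mulrC.
by rewrite ler_pdivrMr ?ang_gt0// mul1r ang_ge.
Qed.

Lemma isC1_expR (R : realType) (V : normedModType R) (f : V -> R) df :
  isC1 f df -> isC1 (fun z => expR (f z)) (fun z v => expR (f z) * df z v).
Proof.
move=> h; apply: (@isC1_comp R V expR expR) => //.
move=> z; apply: (@continuous_comp _ _ _ f expR); last exact: continuous_expR.
exact: (isC1_continuous h).
Qed.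

(** * Maxima, barriers and test functions in space-time *)

Lemma EVT_bool (R : realType) (T : topologicalType) (f : bool -> T -> R)
    (A : set T) : A !=set0 -> compact A -> (forall b, continuous (f b)) ->
  exists b x, A x /\ forall b' y, A y -> f b' y <= f b x.
Proof.
move=> A0 cA cf.
have max b : exists x, A x /\ forall y, A y -> f b y <= f b x.
  have [|x xA hx] := @compact_EVT_max T R (f b) A A0 cA.
    by apply: continuous_subspaceT; exact: cf.
  by exists x; split=> [|y yA]; [exact: set_mem|apply: hx; exact: mem_set].
have [x1 [A1 h1]] := max true; have [x2 [A2 h2]] := max false.
have [le|/ltW le] := leP (f true x1) (f false x2).
  exists false, x2; split=> // -[] y yA; last exact: h2.
  exact: le_trans (h1 _ yA) le.
exists true, x1; split=> // -[] y yA; first exact: h1.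
exact: le_trans (h2 _ yA) le.
Qed.

Lemma near_lt (R : realType) (T : topologicalType) (f : T -> R) (a : R) z0 :
  continuous f -> f z0 < a -> \forall z \near z0, f z < a.
Proof. by move=> cf h; apply: (cvgr_lt (f z0)); [exact: cf|]. Qed.

Lemma near_gt (R : realType) (T : topologicalType) (f : T -> R) (a : R) z0 :
  continuous f -> a < f z0 -> \forall z \near z0, a < f z.
Proof. by move=> cf h; apply: (cvgr_gt (f z0)); [exact: cf|]. Qed.

(** Steepness for exponential barriers: negligible at the point to be kept, prohibitive at the
    boundary to be avoided. The witness works because exp X exceeds X. *)
Lemma expR_steep (R : realType) (a m N : R) : 0 < a -> 0 < m ->
  exists2 k, 0 < k & expR (k * - a) <= m /\ N <= expR (k * a).
Proof.
move=> a0 m0; exists ((m^-1 + `|N|) / a).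
  by rewrite divr_gt0// ltr_wpDr// invr_gt0.
have E : (m^-1 + `|N|) / a * a = m^-1 + `|N| by rewrite divfK// gt_eqF.
rewrite mulrN E; have := expR_ge1Dx (m^-1 + `|N|); set X := expR _ => hX.
have m1 : 0 < m^-1 by rewrite invr_gt0.
have N0 := normr_ge0 N; have NN := ler_norm N.
split; last lra.
rewrite expRN -/X -[leRHS]invrK lef_pV2 ?posrE; lra.
Qed.

Lemma small_factor (R : realType) (a b c : R) : 0 <= a -> 0 <= b -> 0 <= c ->
  exists2 x, 0 < x & [/\ x * a <= 1, x * b <= 1 & x * c <= 1].
Proof.
move=> a0 b0 c0; exists (1 + a + b + c)^-1; first by rewrite invr_gt0; lra.
by rewrite !(mulrC _^-1) !ler_pdivrMr; try split; lra.
Qed.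

Definition isC1t (R : realType) (n : nat) (f : 'rV[R]_n * R -> R)
    (fx : 'rV[R]_n * R -> 'rV[R]_n) (ft : 'rV[R]_n * R -> R) : Prop :=
  isC1 f (fun z v => dot (fx z) v.1 + ft z * v.2).

Lemma space_gradE (R : realType) n (f : 'rV[R]_n * R -> R) fx ft : isC1t f fx ft ->
  forall z, space_grad (fun v => 'D_v f z) = fx z.
Proof.
move=> h z; apply/rowP => i; rewrite mxE (isC1_derive h) /= mulr0 addr0.
exact: dot_delta.
Qed.

Lemma dot0 (R : realType) n (p : 'rV[R]_n) : dot p 0 = 0.
Proof. by rewrite -(scale0r 0) dotZr mul0r. Qed.

Lemma time_derivE (R : realType) n (f : 'rV[R]_n * R -> R) fx ft : isC1t f fx ft ->
  forall z, time_deriv (fun v => 'D_v f z) = ft z.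
Proof. by move=> h z; rewrite /time_deriv (isC1_derive h) /= dot0 add0r mulr1. Qed.

Lemma system_sub_test (R : realType) n (H : 'rV[R]_n -> 'rV[R]_n -> R)
    T eps w Z f fx ft z0 :
  visc_subsolution (open_strip T) (system_eq H eps w) Z -> isC1t f fx ft ->
  0 < z0.2 < T -> (\forall z \near z0, Z z - f z <= Z z0 - f z0) ->
  ft z0 + H (eps^-1 *: z0.1) (fx z0) + eps^-1 * (Z z0 - w z0) <= 0.
Proof.
move=> h hf z0T /(h _ _ (isC1_C1_on hf) z0T).
by rewrite /system_eq (time_derivE hf) (space_gradE hf).
Qed.

Lemma cell_super_test (R : realType) n (H : 'rV[R]_n -> 'rV[R]_n -> R)
    P c w v f fx z0 :
  visc_supersolution setT (cell_eq H P c w) v -> isC1 f (fun z u => dot (fx z) u) ->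
  (\forall z \near z0, v z0 - f z0 <= v z - f z) ->
  0 <= H z0 (P + fx z0) + v z0 - w z0 - c.
Proof.
move=> h hf /(h _ _ (isC1_C1_on hf) I); rewrite /cell_eq.
suff -> : \row_i 'D_(delta_mx 0 i) f z0 = fx z0 by [].
by apply/rowP => i; rewrite mxE (isC1_derive hf) dot_delta.
Qed.

Lemma cell_sub_test (R : realType) n (H : 'rV[R]_n -> 'rV[R]_n -> R)
    P c w v f fx z0 :
  visc_subsolution setT (cell_eq H P c w) v -> isC1 f (fun z u => dot (fx z) u) ->
  (\forall z \near z0, v z - f z <= v z0 - f z0) ->
  H z0 (P + fx z0) + v z0 - w z0 - c <= 0.
Proof.
move=> h hf /(h _ _ (isC1_C1_on hf) I); rewrite /cell_eq.
suff -> : \row_i 'D_(delta_mx 0 i) f z0 = fx z0 by [].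
by apply/rowP => i; rewrite mxE (isC1_derive hf) dot_delta.
Qed.

Lemma contD (R : realType) (T : topologicalType) (V : normedModType R) (f g : T -> V) :
  continuous f -> continuous g -> continuous (fun x => f x + g x).
Proof. by move=> cf cg x; apply: continuousD; [exact: cf|exact: cg]. Qed.

Lemma contN (R : realType) (T : topologicalType) (V : normedModType R) (f : T -> V) :
  continuous f -> continuous (fun x => - f x).
Proof. by move=> cf x; apply: continuousN; exact: cf. Qed.

Lemma contM (R : realType) (T : topologicalType) (f g : T -> R) :
  continuous f -> continuous g -> continuous (fun x => f x * g x).
Proof. by move=> cf cg x; apply: continuousM; [exact: cf|exact: cg]. Qed.

Lemma contZ (R : realType) (T : topologicalType) (V : normedModType R) (f : T -> V) a :
  continuous f -> continuous (fun x => a *: f x).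
Proof. by move=> cf x; apply: cvgZl_tmp; exact: cf. Qed.

Lemma cont_comp (T U V : topologicalType) (f : T -> U) (g : U -> V) :
  continuous g -> continuous f -> continuous (fun x => g (f x)).
Proof. by move=> cg cf x; apply: continuous_comp; [exact: cf|exact: cg]. Qed.

Lemma cont_fst (T U V : topologicalType) (f : T -> U * V) :
  continuous f -> continuous (fun x => (f x).1).
Proof. by move=> cf; apply: cont_comp cf => x; exact: cvg_fst. Qed.

Lemma cont_snd (T U V : topologicalType) (f : T -> U * V) :
  continuous f -> continuous (fun x => (f x).2).
Proof. by move=> cf; apply: cont_comp cf => x; exact: cvg_snd. Qed.

Lemma cont_pair (T U V : topologicalType) (f : T -> U) (g : T -> V) :
  continuous f -> continuous g -> continuous (fun x => (f x, g x)).
Proof. by move=> cf cg x; apply: cvg_pair; [exact: cf|exact: cg]. Qed.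

Lemma cont_id (T : topologicalType) : continuous (fun x : T => x).
Proof. by move=> x; exact: cvg_id. Qed.

Ltac cont :=
  lazymatch goal with
  | |- forall x, continuous_at x ?F =>
    lazymatch F with
    | (fun x => x) => exact: cont_id
    | (fun _ => ?c) => exact: cst_continuous
    | (fun y => fst (@?f y)) => apply: (@cont_fst _ _ _ f); cont
    | (fun y => snd (@?f y)) => apply: (@cont_snd _ _ _ f); cont
    | (fun y => (@?f y, @?g y)) => apply: (@cont_pair _ _ _ f g); cont
    | (fun y => @?f y + @?g y) => apply: (@contD _ _ _ f g); cont
    | (fun y => - @?f y) => apply: (@contN _ _ _ f); cont
    | (fun y => @?f y * @?g y) => apply: (@contM _ _ f g); cont
    | (fun y => ?a *: @?f y) => apply: (@contZ _ _ _ f a); cont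
    | (fun y => enorm (@?f y)) => apply: (@continuous_enorm _ _ _ f); cont
    | (fun y => dot (@?f y) (@?g y)) => apply: (@continuous_dot _ _ _ f g); cont
    | (fun y => expR (@?f y)) => apply: (@cont_comp _ _ _ f expR); [exact: continuous_expR|cont]
    | (fun y => ?h (@?f y)) =>
        apply: (@cont_comp _ _ _ f h); [first [assumption | solve [auto] | idtac]|cont]
    | _ => try assumption
    end
  | _ => idtac
  end.

Lemma lip_continuous (R : realType) n (v : 'rV[R]_n -> R) M : 0 < M ->
  (forall x y, v x - v y <= M * enorm (x - y)) -> continuous v.
Proof.
move=> M0 h x; apply/(@cvgrPdist_lt R R 'rV[R]_n (nbhs (x : 'rV[R]_n)) _ v (v x)) => e e0.
have c : continuous (fun y : 'rV[R]_n => M * enorm (x - y)) by cont.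
have := @near_lt _ _ _ e x c.
rewrite subrr enorm0 mulr0 => /(_ e0); apply: filterS => y.
apply: le_lt_trans; rewrite ler_norml h andbT lerNl opprB enormB; exact: h.
Qed.

(** For [k] nonnegative the time derivative is at least [L] times the length of the space gradient.
    With [L] a Lipschitz constant of the Hamiltonian, adding the barrier preserves
    supersolutions. *)
Lemma isC1t_barrier (R : realType) n (xs : 'rV[R]_n) (k L r : R) :
  let E := fun z : 'rV[R]_n * R => expR (k * (ang 1 xs z.1 + L * z.2 - r)) in
  isC1t E (fun z => (k * E z) *: dang 1 xs z.1) (fun z => k * E z * L).
Proof.
move=> E.
have h := isC1_expR (isC1Z k (isC1D (isC1D (isC1_fst R (isC1_ang xs (@ltr01 R)))
  (isC1Z L (isC1_snd 'rV[R]_n (isC1_id R)))) (isC1_cst _ (- r)))).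
by apply: isC1_eq h _ _ => // z v /=; rewrite /E dotZl; ring.
Qed.

Lemma isC1tD (R : realType) n (f g : 'rV[R]_n * R -> R) fx ft gx gt :
  isC1t f fx ft -> isC1t g gx gt ->
  isC1t (fun z => f z + g z) (fun z => fx z + gx z) (fun z => ft z + gt z).
Proof.
by move=> h k; apply: isC1_eq (isC1D h k) _ _ => // z v; rewrite dotDl; ring.
Qed.

Lemma isC1t_time (R : realType) n (a b : R) :
  isC1t (fun z : 'rV[R]_n * R => a * (z.2 - b)) (fun _ => 0) (fun _ => a).
Proof.
have h := isC1Z a (isC1D (isC1_snd 'rV[R]_n (isC1_id R)) (isC1_cst _ (- b))).
by apply: isC1_eq h _ _ => // z v /=; rewrite dotC dot0; ring.
Qed.

Lemma isC1t_space (R : realType) n (f : 'rV[R]_n -> R) fx :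
  isC1 f (fun x v => dot (fx x) v) ->
  isC1t (fun z : 'rV[R]_n * R => f z.1) (fun z => fx z.1) (fun _ => 0).
Proof.
move=> h; apply: isC1_eq (isC1_fst R h) _ _ => // z v; by rewrite mul0r addr0.
Qed.

Lemma isC1_quad (R : realType) n (a : R) (y : 'rV[R]_n) :
  isC1 (fun x => a * dot (x - y) (x - y)) (fun x v => dot ((2 * a) *: (x - y)) v).
Proof.
apply: isC1_eq (isC1Z a (isC1_sq y)) _ _ => // z v; rewrite dotZl; ring.
Qed.

(** * Comparison of subsolutions with perturbed correctors *)

(** Periodicity gives uniformity in space only over bounded slopes. This suffices, since the
    doubling slope is bounded through the Lipschitz constant of the correctors. *)
Definition unif_in_space (R : realType) (n : nat) (H : 'rV[R]_n -> 'rV[R]_n -> R) :=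
  forall K e : R, 0 < e -> exists2 d, 0 < d &
    forall x y p, enorm (x - y) <= d -> enorm p <= K -> H x p - H y p < e.

(* The two components are indexed by [bool]: the partner of [b] is [~~ b].
   Only the space variable is doubled.  No growth of [Z] is assumed: the barrier
   [E], which moves at the propagation speed [CH], localises to a backward cone. *)
Lemma comparison_lt (R : realType) (n : nat) (H : bool -> 'rV[R]_n -> 'rV[R]_n -> R)
    (CH eps T t1 M c : R) (P : 'rV[R]_n) (Z : bool -> 'rV[R]_n * R -> R)
    (v : bool -> 'rV[R]_n -> R) (l : 'rV[R]_n * R -> R) lx lt :
  0 < eps -> 0 < CH -> 0 <= t1 -> 0 < M ->
  (forall b x p q, `|H b x p - H b x q| <= CH * enorm (p - q)) ->
  (forall b, unif_in_space (H b)) ->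
  (forall b, continuous (Z b)) ->
  (forall b, visc_subsolution (open_strip T) (system_eq (H b) eps (Z (~~ b))) (Z b)) ->
  (forall b x y, v b x - v b y <= M * enorm (x - y)) ->
  (forall b, visc_supersolution setT (cell_eq (H b) P c (v (~~ b))) (v b)) ->
  isC1t l lx lt ->
  (forall z, t1 <= z.2 -> - c + CH * enorm (lx z - P) <= lt z) ->
  (forall b x, Z b (x, t1) <= l (x, t1) + eps * v b (eps^-1 *: x)) ->
  forall b x t, t1 <= t < T -> Z b (x, t) <= l (x, t) + eps * v b (eps^-1 *: x).
Proof.
move=> eps0 CH0 t10 M0 Hlip Huc cZ subZ lipv supv hl hlt init bs xs ts /andP[t1ts tsT].
rewrite leNgt; apply/negP => viol.
pose m := Z bs (xs, ts) - (l (xs, ts) + eps * v bs (eps^-1 *: xs)).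
have m0 : 0 < m by rewrite subr_gt0.
have T0 : 0 < T by lra.
(* A time slope [th] makes the supersolution strict and costs at most a quarter of the violation [m]
   over the whole interval. *)
pose th := m / (4 * T); have th0 : 0 < th by rewrite divr_gt0// mulr_gt0.
have thT : th * T = m / 4 by rewrite /th; field; rewrite gt_eqF.
(* The barrier exponent is [- a] times [k] at (xs, ts), and at least [a] times [k] at time [T'],
   because [ang 1] is at least 1. *)
pose T' := (ts + T) / 2; pose r := 1 + CH * ((ts + T') / 2).
pose a := CH * ((T' - ts) / 2).
have T'T : ts < T' < T by rewrite /T'; apply/andP; split; lra.
have a0 : 0 < a by rewrite mulr_gt0//; lra.
pose r' := r + a.
have r'0 : 0 < r'.
  have h : 0 < CH * ((ts + T') / 2) by rewrite mulr_gt0//; lra.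
  by rewrite /r' /r; lra.
have cv b : continuous (v b) by exact: lip_continuous M0 (lipv b).
have cl : continuous l by exact: isC1_continuous hl.
pose K0 : set ('rV[R]_n * R) := [set x | enorm (x - xs) <= r'] `*` `[t1, T']%classic.
have K0E x t : K0 (x, t) <-> enorm (x - xs) <= r' /\ t1 <= t <= T'.
  by rewrite /K0 /setX /= in_itv.
have cK0 : compact K0.
  by apply: compact_setX; [exact: compact_eball|exact: segment_compact].
have K0s : K0 (xs, ts).
  by apply/K0E; rewrite subrr enorm0 (ltW r'0) t1ts; split=> //; lra.
pose W := fun b (z : 'rV[R]_n * R) => Z b z - (l z + eps * v b (eps^-1 *: z.1)).
have cW b : continuous (W b).
  by rewrite /W; cont.
have [b1 [z1 [_ hN]]] := EVT_bool (ex_intro _ _ K0s) cK0 cW.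
set N := W b1 z1 in hN.
have [k k0 [km kN]] := expR_steep (N + m) a0 (divr_gt0 m0 (ltr0n _ 4)).
pose E := fun z : 'rV[R]_n * R => expR (k * (ang 1 xs z.1 + CH * z.2 - r)).
have hE := isC1t_barrier xs k CH r; rewrite /= -/E in hE.
have E0 z : 0 < E z by exact: expR_gt0.
have [d d0 hd] : exists2 d, 0 < d & forall b x y p, enorm (x - y) <= d ->
    enorm p <= enorm P + 2 * M -> H b x p - H b y p < th.
  have [d1 d10 h1] := Huc true (enorm P + 2 * M) _ th0.
  have [d2 d20 h2] := Huc false (enorm P + 2 * M) _ th0.
  exists (Num.min d1 d2); first by rewrite lt_min d10.
  by move=> [] x y p; rewrite le_min => /andP[i1 i2]; [exact: h1|exact: h2].
(* Three demands on the doubling parameter: it costs at most m / 4 in value, [y0] stays inside the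
   ball of radius [r' + 1], and the two points divided by eps are within [d]. *)
have [al al0 [al1 al2 al3]] : exists2 al, 0 < al &
    [/\ al * (2 * M ^+ 2 / m) <= 1, al * (4 * M) <= 1 & al * (2 * M / (eps * d)) <= 1].
  apply: small_factor; [|by rewrite mulr_ge0// ltW|].
    by rewrite divr_ge0 ?mulr_ge0 ?sqr_ge0// ltW.
  by rewrite divr_ge0 ?mulr_ge0// ltW.
have {}al1 : al * M ^+ 2 / 2 <= m / 4.
  have : al * (2 * M ^+ 2 / m) * (m / 4) <= 1 * (m / 4) by rewrite ler_wpM2r//; lra.
  rewrite mul1r; apply: le_trans; rewrite le_eqVlt; apply/orP; left; apply/eqP.
  by field; rewrite gt_eqF.
have {}al3 : al * (2 * M) <= eps * d.
  have ed0 : 0 < eps * d by rewrite mulr_gt0.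
  by rewrite -[leRHS]mul1r -ler_pdivrMr// -mulrA.
pose l' := fun z : 'rV[R]_n * R => l z + (th * (z.2 - t1) + E z).
pose Phi := fun b (z : ('rV[R]_n * R) * 'rV[R]_n) => Z b z.1 - l' z.1
  - eps * v b (eps^-1 *: z.2) - (2 * al)^-1 * dot (z.1.1 - z.2) (z.1.1 - z.2).
pose K := K0 `*` [set y | enorm (y - xs) <= r' + 1].
have KE x t y : K (x, t, y) <-> [/\ enorm (x - xs) <= r', t1 <= t <= T' & enorm (y - xs) <= r' + 1].
  by split=> [[/K0E[h1 h2] h3]|[h1 h2 h3]]; split=> //; apply/K0E.
have cK : compact K by apply: compact_setX => //; exact: compact_eball.
have Ks : K (xs, ts, xs).
  apply/KE; rewrite subrr enorm0; split; first exact: ltW.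
    by rewrite t1ts ltW//; case/andP: T'T.
  by rewrite addr_ge0// ltW.
have cPhi b : continuous (Phi b).
  have cl' : continuous l' by exact: isC1_continuous (isC1D hl (isC1D (isC1t_time n th t1) hE)).
  by rewrite /Phi; cont.
have [b0 [[[x0 t0] y0] [/KE[Kx Kt Ky] hmax]]] := EVT_bool (ex_intro _ _ Ks) cK cPhi.
have Phis : m / 2 <= Phi b0 (x0, t0, y0).
  apply: le_trans (hmax bs _ Ks); rewrite /Phi /l' /= /E /= ang_center//.
  have -> : 1 + CH * ts - r = - a by rewrite /r /a; field.
  rewrite subrr dot0 mulr0.
  have : th * (ts - t1) <= th * T by rewrite ler_pM2l// (le_trans _ (ltW tsT))// gerBl.
  by move: km; rewrite thT -/m /m; lra.
(* Moving [y0] to [x0] cannot increase [Phi], and only the [M]-Lipschitz corrector changes besides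
   the penalty; so the quadratic penalty is at most [M * enorm (x0 - y0)]. *)
have xy : enorm (x0 - y0) <= 2 * M * al.
  have Kxx : K (x0, t0, x0) by apply/KE; split=> //; rewrite (le_trans Kx)// lerDl.
  have := hmax b0 _ Kxx; rewrite /Phi /= subrr dot0 mulr0 subr0 => h.
  have h2 := lipv b0 (eps^-1 *: x0) (eps^-1 *: y0).
  have : eps * (v b0 (eps^-1 *: x0) - v b0 (eps^-1 *: y0)) <= M * enorm (x0 - y0).
    rewrite -ler_pdivlMl//; apply: le_trans h2 _; rewrite -scalerBr enormZ.
    by rewrite gtr0_norm ?invr_gt0// mulrCA.
  rewrite -sqr_enorm in h => h3.
  have h4 : (2 * al)^-1 * enorm (x0 - y0) ^+ 2 <= M * enorm (x0 - y0) by move: h h3; clear; lra.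
  have [->|nz] := eqVneq (enorm (x0 - y0)) 0; first by rewrite !mulr_ge0// ltW.
  have nz0 : 0 < enorm (x0 - y0) by rewrite lt_def nz enorm_ge0.
  move: h4; rewrite expr2 mulrA ler_pM2r// ler_pdivrMl ?mulr_gt0//; clear; lra.
have up x t y b : Phi b (x, t, y) <= W b (x, t) - th * (t - t1) - E (x, t) + m / 4.
  have h2 := lipv b (eps^-1 *: x) (eps^-1 *: y).
  have h3 : eps * (v b (eps^-1 *: x) - v b (eps^-1 *: y)) <= M * enorm (x - y).
    rewrite -ler_pdivlMl//; apply: le_trans h2 _; rewrite -scalerBr enormZ.
    by rewrite gtr0_norm ?invr_gt0// mulrCA.
  rewrite /Phi /W /l' /= -sqr_enorm.
  have h4 : 0 <= (2 * al)^-1 * (enorm (x - y) - al * M) ^+ 2.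
    by rewrite mulr_ge0 ?sqr_ge0// invr_ge0 mulr_ge0// ltW.
  have h5 : (2 * al)^-1 * (enorm (x - y) - al * M) ^+ 2 =
      (2 * al)^-1 * enorm (x - y) ^+ 2 - M * enorm (x - y) + al * M ^+ 2 / 2.
    by field; rewrite gt_eqF.
  move: h3 h4 al1; rewrite h5; clear; lra.
have {}up := le_trans Phis (up x0 t0 y0 b0).
(* On or beyond the cone the barrier is at least [N + m], more than [W] can compensate. Interiority
   in x, y and at the upper end in time follows. *)
have rho : ang 1 xs x0 + CH * t0 - r < a.
  rewrite ltNge; apply/negP => h.
  have : expR (k * a) <= E (x0, t0) by rewrite ler_expR ler_pM2l.
  have : W b0 (x0, t0) <= N by apply: hN; exact/K0E.
  have : 0 <= th * (t0 - t1) by rewrite mulr_ge0 ?(ltW th0)// subr_ge0; case/andP: Kt.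
  move: up m0 kN; clear; lra.
have t10lt : t1 < t0.
  have [t1t0 _] := andP Kt; rewrite lt_def t1t0 andbT; apply/eqP => e.
  have := init b0 x0; have := E0 (x0, t0); move: up m0; rewrite /W e subrr mulr0 /=; clear; lra.
have CHt0 : 0 <= CH * t0 by rewrite mulr_ge0 ?(ltW CH0)// (le_trans t10)// ltW.
have t0lt : t0 < T'.
  rewrite ltNge; apply/negP => h; have := ang_ge_s xs x0 (@ler01 R).
  have : CH * T' <= CH * t0 by rewrite ler_pM2l.
  move: rho; rewrite /r /a; clear; lra.
have x0lt : enorm (x0 - xs) < r'.
  move: (ang_ge 1 xs x0) rho CHt0; rewrite /r'; clear; lra.
have y0lt : enorm (y0 - xs) < r' + 1.
  move: (enorm_tri x0 y0 xs) xy al2 x0lt; rewrite (enormB y0 x0); clear; lra.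
pose q := al^-1 *: (x0 - y0).
have qE : enorm q <= 2 * M.
  by rewrite enormZ gtr0_norm ?invr_gt0// ler_pdivrMl// mulrC.
have sub : lt (x0, t0) + (th + k * E (x0, t0) * CH)
    + H b0 (eps^-1 *: x0) (lx (x0, t0) + (k * E (x0, t0)) *: dang 1 xs x0 + q)
    + eps^-1 * (Z b0 (x0, t0) - Z (~~ b0) (x0, t0)) <= 0.
  have hphi := isC1tD (isC1tD hl (isC1tD (isC1t_time n th t1) hE))
    (isC1t_space (isC1_quad (2 * al)^-1 y0)).
  have := system_sub_test (subZ b0) hphi.
  move=> /(_ (x0, t0)) /=; rewrite add0r addr0 invfM mulVKf ?pnatr_eq0//; apply.
    by rewrite (le_lt_trans t10 t10lt) (lt_trans t0lt)//; case/andP: T'T.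
  have n1 := @near_lt R _ (fun z : 'rV[R]_n * R => enorm (z.1 - xs)) r' (x0, t0)
    ltac:(cont) x0lt.
  have n2 := @near_lt R _ (fun z : 'rV[R]_n * R => z.2) T' (x0, t0) ltac:(cont) t0lt.
  have n3 := @near_gt R _ (fun z : 'rV[R]_n * R => z.2) t1 (x0, t0) ltac:(cont) t10lt.
  near=> z.
  have Kz : K (z.1, z.2, y0).
    apply/KE; split=> //; first by apply/ltW; near: z.
    by apply/andP; split; apply/ltW; near: z.
  have := hmax b0 _ Kz; rewrite /Phi /l' /= -!surjective_pairing; clear; lra.
(* In the fast variable y / eps the penalty has coefficient eps / (2 al), and the gradient of the
   test function at contact is again [q]. *)
have sup : 0 <= H b0 (eps^-1 *: y0) (P + q) + v b0 (eps^-1 *: y0)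
    - v (~~ b0) (eps^-1 *: y0) - c.
  have := cell_super_test (supv b0) (isC1_quad (- (eps / (2 * al))) (eps^-1 *: x0)).
  move=> /(_ (eps^-1 *: y0)).
  have -> : (2 * - (eps / (2 * al))) *: (eps^-1 *: y0 - eps^-1 *: x0) = q.
    rewrite -scalerBr scalerA /q -opprB scalerN -scaleNr; congr (_ *: _).
    by field; rewrite !gt_eqF.
  apply.
  have n1 := @near_lt R _ (fun x : 'rV[R]_n => enorm (eps *: x - xs)) (r' + 1)
    (eps^-1 *: y0) ltac:(cont).
  have {}n1 := n1 ltac:(by rewrite scalerA divff ?gt_eqF// scale1r).
  near=> x.
  have Kx' : K (x0, t0, eps *: x).
    by apply/KE; split=> //; apply/ltW; near: x.
  have := hmax b0 _ Kx'; rewrite /Phi /= scalerA mulVf ?gt_eqF// scale1r.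
  have dq y : dot (x0 - y) (x0 - y) = eps ^+ 2 *
      dot (eps^-1 *: y - eps^-1 *: x0) (eps^-1 *: y - eps^-1 *: x0).
    rewrite -scalerBr dotZl dotZr -(opprB y x0) dotNl dotNr opprK.
    by field; rewrite gt_eqF.
  rewrite !dq scalerA mulVf ?gt_eqF// scale1r => h.
  rewrite -(ler_pM2l eps0); move: h.
  set A := dot _ _; set B := dot _ _.
  have e (X : R) : eps * (- (eps / (2 * al)) * X) = - ((2 * al)^-1 * (eps ^+ 2 * X)).
    by field; rewrite gt_eqF.
  rewrite !mulrBr !e; clear; lra.
(* The maximum also runs over the component: switching to the partner at the same point orders the
   coupling terms of the two inequalities. *)
have idx : v b0 (eps^-1 *: y0) - v (~~ b0) (eps^-1 *: y0) <=
    eps^-1 * (Z b0 (x0, t0) - Z (~~ b0) (x0, t0)).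
  have K0' : K (x0, t0, y0) by apply/KE.
  have := hmax (~~ b0) _ K0'; rewrite /Phi /= ler_pdivlMl// mulrBr; clear; lra.
have lipH : H b0 (eps^-1 *: x0) (P + q) - CH * (enorm (lx (x0, t0) - P) + k * E (x0, t0)) <=
    H b0 (eps^-1 *: x0) (lx (x0, t0) + (k * E (x0, t0)) *: dang 1 xs x0 + q).
  have := Hlip b0 (eps^-1 *: x0) (P + q)
    (lx (x0, t0) + (k * E (x0, t0)) *: dang 1 xs x0 + q).
  move=> /(le_trans (ler_norm _)).
  have : enorm (P + q - (lx (x0, t0) + (k * E (x0, t0)) *: dang 1 xs x0 + q)) <=
      enorm (lx (x0, t0) - P) + k * E (x0, t0).
    rewrite enormB opprD addrACA subrr addr0.
    apply: le_trans (_ : enorm ((lx (x0, t0) - P) + (k * E (x0, t0)) *: dang 1 xs x0) <= _).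
      by rewrite addrAC.
    apply: le_trans (enormD _ _) _; rewrite lerD2l enormZ gtr0_norm ?mulr_gt0//.
    by rewrite -[leRHS]mulr1 ler_pM2l ?mulr_gt0// enorm_dang.
  rewrite -(ler_pM2l CH0); clear; lra.
have uc : H b0 (eps^-1 *: y0) (P + q) - H b0 (eps^-1 *: x0) (P + q) < th.
  apply: hd; last by apply: le_trans (enormD _ _) _; rewrite lerD2l.
  rewrite -scalerBr enormZ gtr0_norm ?invr_gt0// ler_pdivrMl// enormB.
  by apply: le_trans xy _; rewrite mulrC.
(* The barrier terms cancel and [hlt] absorbs [lx - P]; what remains is that [th] is at most the
   oscillation in [uc], which is less than [th]. *)
move: (hlt (x0, t0) (ltW t10lt)) sub sup idx lipH uc; clear; lra.
Unshelve. all: by end_near. Qed.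

(** Viscosity inequalities hold only before the final time; continuity carries the estimates to
    it. *)
Lemma le_at_endpoint (R : realType) (h : R -> R) (a b : R) : a <= b ->
  continuous h -> (forall s, a <= s < b -> h s <= 0) -> h a <= 0 -> h b <= 0.
Proof.
move=> ab ch hs ha; rewrite leNgt; apply/negP => hb.
have [e /= e0 he] : nbhs b [set s | 0 < h s] by exact: (@near_gt R R h 0 b ch hb).
have ltab : a < b.
  by rewrite lt_def ab andbT; apply/eqP => E; move: hb; rewrite E; lra.
pose s := b - Num.min (e / 2) (b - a).
have m0 : 0 < Num.min (e / 2) (b - a) by rewrite lt_min; apply/andP; split; lra.
have m1 : Num.min (e / 2) (b - a) <= e / 2 by rewrite ge_min lexx.
have m2 : Num.min (e / 2) (b - a) <= b - a by rewrite ge_min lexx orbT.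
have : h s <= 0 by apply: hs; rewrite /s; apply/andP; split; lra.
suff : 0 < h s by lra.
by apply: he; rewrite /= /s opprB addrC subrK gtr0_norm; lra.
Qed.

Lemma comparison (R : realType) (n : nat) (H : bool -> 'rV[R]_n -> 'rV[R]_n -> R)
    (CH eps T t1 M c : R) (P : 'rV[R]_n) (Z : bool -> 'rV[R]_n * R -> R)
    (v : bool -> 'rV[R]_n -> R) (l : 'rV[R]_n * R -> R) lx lt :
  0 < eps -> 0 < CH -> 0 <= t1 -> 0 < M ->
  (forall b x p q, `|H b x p - H b x q| <= CH * enorm (p - q)) ->
  (forall b, unif_in_space (H b)) ->
  (forall b, continuous (Z b)) ->
  (forall b, visc_subsolution (open_strip T) (system_eq (H b) eps (Z (~~ b))) (Z b)) ->
  (forall b x y, v b x - v b y <= M * enorm (x - y)) ->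
  (forall b, visc_supersolution setT (cell_eq (H b) P c (v (~~ b))) (v b)) ->
  isC1t l lx lt ->
  (forall z, t1 <= z.2 -> - c + CH * enorm (lx z - P) <= lt z) ->
  (forall b x, Z b (x, t1) <= l (x, t1) + eps * v b (eps^-1 *: x)) ->
  forall b x t, t1 <= t <= T -> Z b (x, t) <= l (x, t) + eps * v b (eps^-1 *: x).
Proof.
move=> e0 CH0 t10 M0 Hl Hu cZ sZ lv sv hl hlt init b x t /andP[t1t].
rewrite le_eqVlt => /predU1P[E|tT]; last first.
  by apply: (comparison_lt e0 CH0 t10 M0 Hl Hu cZ sZ lv sv hl hlt init); rewrite t1t.
have cl : continuous l by exact: isC1_continuous hl.
have cb := cZ b.
have : Z b (x, t) - (l (x, t) + eps * v b (eps^-1 *: x)) <= 0; last lra.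
apply: (@le_at_endpoint R (fun t => Z b (x, t) - (l (x, t) + eps * v b (eps^-1 *: x))) t1) => //.
- by cont.
- move=> s /andP[s1 s2].
  rewrite subr_le0; apply: (comparison_lt e0 CH0 t10 M0 Hl Hu cZ sZ lv sv hl hlt init).
  by rewrite s1 -E.
- by rewrite subr_le0.
Qed.

Lemma derive_line (R : realType) (V : normedModType R) (f : V -> R) (z v : V) :
  'D_1 (fun s : R => f (s *: v + z)) 0 = 'D_v f z.
Proof.
rewrite /derive; set F := (X in lim (X @ _) = _); set G := (X in _ = lim (X @ _)).
suff -> : F = G by [].
by apply/funext => h; rewrite /F /G /=; rewrite /shift/= scale0r add0r addr0 /GRing.scale/= mulr1.
Qed.

Lemma near_comp (T U : topologicalType) (f : T -> U) (x : T) (y : U) (P : set U) :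
  continuous f -> f x = y -> (\forall z \near y, P z) -> \forall z \near x, P (f z).
Proof. by move=> cf <- h; exact: (cf x _ h). Qed.

Lemma derive_local_max (R : realType) (V : normedModType R) (f : V -> R) (z v : V) :
  (\forall s \near (0 : R), differentiable f (s *: v + z)) ->
  (\forall s \near (0 : R), f (s *: v + z) <= f z) -> 'D_v f z = 0.
Proof.
move=> df fm.
have [e /= e0 he] : nbhs (0 : R) [set s |
    differentiable f (s *: v + z) /\ f (s *: v + z) <= f z].
  by apply: filterS2 df fm.
have inI t : t \in `](- e), e[%R -> differentiable f (t *: v + z) /\ f (t *: v + z) <= f z.
  rewrite in_itv /= => t0; apply: he; rewrite /= sub0r normrN ltr_norml; exact: t0.
have [||||_ d0] := @derive1_at_max R (fun s => f (s *: v + z)) (- e) e 0.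
- by lra.
- move=> t /inI[d _]; apply/derivable1_diffP.
  by apply: (@differentiable_comp _ _ _ _ (fun s : R => s *: v + z) f).
- by rewrite in_itv /=; apply/andP; split; lra.
- by move=> t /inI[_]; rewrite scale0r add0r.
by rewrite -derive_line.
Qed.

(** A test function touching a constant from below has zero gradient at contact, and equal
    components cancel the coupling. *)
Lemma cell_super_const (R : realType) n (H : 'rV[R]_n -> 'rV[R]_n -> R) c P :
  (forall x, c <= H x P) ->
  visc_supersolution setT (cell_eq H P c (fun _ => 0)) (fun _ => 0).
Proof.
move=> h phi z0 hphi _ hmin.
rewrite /cell_eq.
suff -> : \row_i 'D_(delta_mx 0 i) phi z0 = 0 by rewrite !addr0 subr0 subr_ge0.
apply/rowP => i; rewrite !mxE; apply: derive_local_max.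
  apply: (@filterE _ (nbhs (0 : R))) => s.
  by have [] := hphi (s *: delta_mx 0 i + z0) I.
have cl : continuous (fun s : R => s *: delta_mx 0 i + z0 : 'rV[R]_n).
  by apply: contD; [move=> x; exact: scalel_continuous|cont].
have e0 : 0 *: delta_mx 0 i + z0 = z0 by rewrite scale0r add0r.
have := near_comp cl e0 hmin; apply: filterS => s.
by rewrite !sub0r lerN2.
Qed.

(** Comparison at slope 0 with zero correctors and constant [- c0]; the gradient of [g] adds
    [CH * L] to the time slope. *)
Lemma growth (R : realType) (n : nat) (H : bool -> 'rV[R]_n -> 'rV[R]_n -> R)
    (CH eps T c0 L : R) (Z : bool -> 'rV[R]_n * R -> R) (g : 'rV[R]_n -> R) gx :
  0 < eps -> 0 < CH ->
  (forall b x p q, `|H b x p - H b x q| <= CH * enorm (p - q)) ->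
  (forall b, unif_in_space (H b)) ->
  (forall b x, - c0 <= H b x 0) ->
  (forall b, continuous (Z b)) ->
  (forall b, visc_subsolution (open_strip T) (system_eq (H b) eps (Z (~~ b))) (Z b)) ->
  isC1 g (fun x v => dot (gx x) v) -> (forall x, enorm (gx x) <= L) ->
  (forall b x, Z b (x, 0) <= g x) ->
  forall b x t, 0 <= t <= T -> Z b (x, t) <= g x + (c0 + CH * L) * t.
Proof.
move=> e0 CH0 Hl Hu hc cZ sZ hg hL init b x t tT.
have hl := isC1tD (isC1t_space hg) (isC1t_time n (c0 + CH * L) 0).
have := @comparison R n H CH eps T 0 1 (- c0) 0 Z (fun _ _ => 0) _ _ _ e0 CH0
  (lexx _) ltr01 Hl Hu cZ sZ _ _ hl.
move=> h.
rewrite (_ : g x + _ = g x + (c0 + CH * L) * (t - 0) + eps * 0); last by ring.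
apply: h => //.
- by move=> b' y y'; rewrite subr0 mul1r enorm_ge0.
- by move=> b'; exact: cell_super_const.
- by move=> z _; rewrite addr0 subr0 add0r opprK lerD2l ler_pM2l.
- by move=> b' y; rewrite subr0 !mulr0 !addr0.
Qed.

(** Turns the cell problem into an evolution with eps = 1, so that different slopes can be compared
    over long times. The candidate is affine in time, which forces the time derivative [- c] at
    contact; the time slice of the test function, tilted by [P], then tests [v]. *)
Lemma cell_to_system (R : realType) n (H : 'rV[R]_n -> 'rV[R]_n -> R) P c w v T :
  visc_subsolution setT (cell_eq H P c w) v ->
  visc_subsolution (open_strip T)
    (system_eq H 1 (fun z => dot P z.1 + w z.1 - c * z.2))
    (fun z => dot P z.1 + v z.1 - c * z.2).
Proof.
move=> hv phi [x0 t0] hphi z0T hmax; rewrite /system_eq /= !invr1 scale1r mul1r.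
have dphi z : open_strip T z -> is_diff z phi ('d phi z).
  by move=> /hphi[d _]; exact: DiffDef.
have ht : 'D_(0, 1) phi (x0, t0) = - c.
  pose f := fun z : 'rV[R]_n * R => - phi z + - c * (z.2 - 0).
  have df z : open_strip T z -> is_diff z f (fun v => - 'd phi z v + (dot 0 v.1 + - c * v.2)).
    by move=> zT; exact: is_diffD (is_diffN (dphi _ zT)) ((isC1t_time n (- c) 0).1 z).
  have cl : continuous (fun s : R => s *: ((0, 1) : 'rV[R]_n * R) + (x0, t0)).
    by apply: contD; [move=> x; exact: scalel_continuous|cont].
  have : 'D_(0, 1) f (x0, t0) = 0.
    apply: derive_local_max.
      have cl2 : continuous (fun s : R => s + t0) by cont.
      have n1 := @near_gt R _ _ 0 0 cl2; have n2 := @near_lt R _ _ T 0 cl2.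
      move: z0T => /andP[/= i1 i2]; rewrite add0r in n1 n2.
      apply: filterS2 (n1 i1) (n2 i2) => s s1 s2.
      have [] // := df (s *: (0, 1) + (x0, t0)).
      by rewrite /open_strip /= /GRing.scale /= mulr1 s1.
    have e0 : 0 *: (0, 1) + (x0, t0) = (x0, t0) by rewrite scale0r add0r.
    have := near_comp cl e0 hmax; apply: filterS => s; rewrite /f /= scaler0 add0r /GRing.scale /= mulr1.
    rewrite (_ : s *: (0, 1) + (x0, t0) = (x0, s + t0)); first lra.
    by congr pair; rewrite /= ?scaler0 ?add0r// /GRing.scale /= mulr1.
  rewrite deriveE; last by have [] := df _ z0T.
  have [_ ->] := df _ z0T; rewrite /= dot0 add0r mulr1 -deriveE; first lra.
  by have [] := hphi _ z0T.
have inT (x : 'rV[R]_n) : open_strip T (x, t0) by [].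
pose psi := fun x : 'rV[R]_n => phi (x, t0) + dot (- P) x.
have dpsi x : is_diff x psi (fun v => 'd phi (x, t0) (v, 0) + dot (- P) v).
  have dp := is_diff_pair (is_diff_id x) (is_diff_cst t0 x).
  exact: is_diffD (is_diff_comp dp (dphi _ (inT x))) ((isC1_dot (- P)).1 x).
have Dpsi e x : 'D_e psi x = 'D_(e, 0) phi (x, t0) + dot (- P) e.
  rewrite deriveE; last by have [] := dpsi x.
  have [_ ->] := dpsi x; rewrite -deriveE//; by have [] := hphi _ (inT x).
have C1psi : C1_on setT psi.
  move=> x _; split; first by have [] := dpsi x.
  move=> e; rewrite (_ : (fun w => _) = fun w => 'D_(e, 0) phi (w, t0) + dot (- P) e);
    last by apply/funext => y; exact: Dpsi.
  apply: continuousD; last exact: cst_continuous.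
  apply: (@continuous_comp _ _ _ (fun w : 'rV[R]_n => (w, t0)) (fun z => 'D_(e, 0) phi z)).
    have ce : continuous (fun y : 'rV[R]_n => (y, t0)) by cont.
    exact: ce.
  by have [_] := hphi _ (inT x); apply.
have := hv psi x0 C1psi I; rewrite /cell_eq.
have -> : P + \row_i 'D_(delta_mx 0 i) psi x0 = space_grad (fun v => 'D_v phi (x0, t0)).
  by apply/rowP => i; rewrite !mxE Dpsi dotNl dot_delta; ring.
rewrite /time_deriv ht; move=> h; have {}h := h _.
suff : \forall z \near x0, v z - psi z <= v x0 - psi x0.
  by move=> /h; lra.
have cl : continuous (fun x : 'rV[R]_n => (x, t0)) by cont.
have := near_comp cl erefl hmax; apply: filterS => x /=; rewrite /psi !dotNl; lra.
Qed.

(** * Bounds on correctors *)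

Definition unit_diam (R : realType) (n : nat) : R := Num.sqrt n%:R.

Lemma periodic_reduce (R : realType) n (x : 'rV[R]_n) :
  exists k : 'rV[int]_n, enorm (x + map_mx intr k) <= unit_diam R n.
Proof.
exists (\row_i - Num.floor (x 0 i)); rewrite /enorm /unit_diam; apply: ler_wsqrtr.
rewrite -[X in _ <= X%:R]card_ord -sum1_card natr_sum; apply: ler_sum => i _.
rewrite !mxE rmorphN /=.
have h0 := ge_floor (x 0 i); have h1 := floorD1_gt (x 0 i).
have h2 : 0 <= x 0 i - (Num.floor (x 0 i))%:~R by rewrite subr_ge0.
have h3 : x 0 i - (Num.floor (x 0 i))%:~R <= 1.
  by move: h1; rewrite intrD1; lra.
by rewrite expr_le1.
Qed.

Lemma periodic_bounded (R : realType) n (v : 'rV[R]_n -> R) :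
  continuous v -> Zperiodic v -> exists N, forall x, v x <= N.
Proof.
move=> cv pv.
have A0 : [set x : 'rV[R]_n | enorm (x - 0) <= unit_diam R n] !=set0.
  by exists 0; rewrite /= subrr enorm0 sqrtr_ge0.
have [_ [x0 [_ h]]] := EVT_bool A0 (@compact_eball R n 0 _) (fun _ : bool => cv).
exists (v x0) => x; have [k hk] := periodic_reduce x.
by rewrite -(pv x k); apply: (h true); rewrite /= subr0.
Qed.

Lemma hamiltonian_bounded (R : realType) n (H : 'rV[R]_n -> 'rV[R]_n -> R) K :
  hamiltonian H -> 0 <= K ->
  exists N, forall x p, enorm p <= K -> `|H x p| <= N.
Proof.
move=> [cH _ pH] K0.
pose A := [set x : 'rV[R]_n | enorm (x - 0) <= unit_diam R n] `*`
  [set p : 'rV[R]_n | enorm (p - 0) <= K].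
have A0 : A !=set0 by exists (0, 0); split; rewrite /= subrr enorm0 ?sqrtr_ge0.
have cA : compact A by apply: compact_setX; exact: compact_eball.
(* The Boolean carries the sign, so a single maximum bounds the absolute value. *)
have cf b : continuous (fun z : 'rV[R]_n * 'rV[R]_n => (-1) ^+ b * H z.1 z.2).
  by apply: contM => //; cont.
have [b0 [z0 [_ h]]] := EVT_bool A0 cA cf.
exists ((-1) ^+ b0 * H z0.1 z0.2) => x p hp; have [k hk] := periodic_reduce x.
rewrite -(pH p x k); set y := x + _ in hk *.
have Ay : A (y, p) by split; rewrite /= subr0.
have := h true _ Ay; have := h false _ Ay; rewrite /= expr0 expr1 mul1r mulN1r.
by move=> h1 h2; rewrite ler_norml h1 andbT; lra.
Qed.

(** By compactness: on the pairs where [H] differs by at least [e] the distance has a positive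
    minimum, and half of it serves. One integer translation brings x near the origin and moves y
    along; a distance at most 1 keeps y in the enlarged ball. *)
Lemma hamiltonian_unif (R : realType) n (H : 'rV[R]_n -> 'rV[R]_n -> R) :
  hamiltonian H -> unif_in_space H.
Proof.
move=> [cH _ pH] K e e0.
pose B r := [set x : 'rV[R]_n | enorm (x - 0) <= r].
pose A := (B (unit_diam R n + 1) `*` B (unit_diam R n + 1)) `*` B K.
pose F := fun z : ('rV[R]_n * 'rV[R]_n) * 'rV[R]_n => H z.1.1 z.2 - H z.1.2 z.2.
have cF : continuous F.
  have c1 : continuous (fun z : ('rV[R]_n * 'rV[R]_n) * 'rV[R]_n => H z.1.1 z.2).
    by apply: (@cont_comp _ _ _ (fun z : ('rV[R]_n * 'rV[R]_n) * 'rV[R]_n => (z.1.1, z.2)) _ cH);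
      cont.
  have c2 : continuous (fun z : ('rV[R]_n * 'rV[R]_n) * 'rV[R]_n => H z.1.2 z.2).
    by apply: (@cont_comp _ _ _ (fun z : ('rV[R]_n * 'rV[R]_n) * 'rV[R]_n => (z.1.2, z.2)) _ cH);
      cont.
  by apply: contD c1 (contN c2).
have cA : compact A by do !apply: compact_setX; exact: compact_eball.
pose S := A `&` [set z | e <= F z].
have cS : compact S.
  apply: (subclosed_compact _ cA); last by move=> z [].
  apply: closedI; first by apply: compact_closed (cA); exact: norm_hausdorff.
  have := @preimage_closed _ _ F [set y | e <= y].
  by apply; [move=> x _; exact: cF|exact: closed_ge].
have red d : 0 < d -> d <= 1 -> (forall z, S z -> ~ enorm (z.1.1 - z.1.2) <= d) ->
    forall x y p, enorm (x - y) <= d -> enorm p <= K -> H x p - H y p < e.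
  move=> d0 d1 hS x y p xy hp; rewrite ltNge; apply/negP => he.
  have [k hk] := periodic_reduce x.
  apply: (hS (x + map_mx intr k, y + map_mx intr k, p)).
    split; last by rewrite /F /= !(pH p).
    split; last by rewrite /B /= subr0.
    split; rewrite /B /= subr0; first by lra.
    have := enorm_tri (x + map_mx intr k) (y + map_mx intr k) 0.
    rewrite !subr0 opprD addrACA subrr addr0 (enormB y); lra.
  by rewrite /= opprD addrACA subrr addr0.
have [S0|/nonemptyPn S0] := pselect (S !=set0); last first.
  by exists 1 => //; apply: red => // z; rewrite S0.
have cd : continuous (fun z : ('rV[R]_n * 'rV[R]_n) * 'rV[R]_n => - enorm (z.1.1 - z.1.2)).
  by cont.
have [_ [z0 [[_ Sz0] h]]] := EVT_bool S0 cS (fun _ : bool => cd).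
have pos : 0 < enorm (z0.1.1 - z0.1.2).
  rewrite lt_def enorm_ge0 andbT; apply/eqP => z00.
  have /eqP : z0.1.1 - z0.1.2 = 0.
    apply/rowP => i; apply/eqP; rewrite [X in _ == X]mxE -normr_eq0 eq_le normr_ge0 andbT.
    by rewrite -z00; exact: coord_le_enorm.
  by rewrite subr_eq0 => /eqP E; move: Sz0; rewrite /F /= E subrr; lra.
exists (Num.min 1 (enorm (z0.1.1 - z0.1.2) / 2)).
  by rewrite lt_min ltr01 divr_gt0.
apply: red; first by rewrite lt_min ltr01 divr_gt0.
  by rewrite ge_min lexx.
by move=> z Sz; have := h true z Sz; rewrite /= le_min; move=> h1 /andP[_ h2]; lra.
Qed.

Lemma coercive_bound (R : realType) n (H : 'rV[R]_n -> 'rV[R]_n -> R) h :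
  coercive H -> exists2 r, 0 < r & forall x p, H x p <= h -> enorm p <= r.
Proof.
move=> /cvgeyPgt /(_ h) [r [_ hr]].
exists (Num.max 1 (r + 1)); first by rewrite lt_max ltr01.
move=> x p hle; rewrite leNgt; apply/negP => hp; move: hle; apply/negP; rewrite -ltNge.
have := hr (Num.max 1 (r + 1)); rewrite lt_max ltrDl ltr01 orbT => /(_ isT).
move=> /= lt_inf; rewrite -lte_fin; apply: lt_le_trans lt_inf _.
by apply: ereal_inf_lbound; exists x, p; split=> //; rewrite ltW.
Qed.

Lemma hamiltonian_lower (R : realType) n (H : 'rV[R]_n -> 'rV[R]_n -> R) :
  hamiltonian H -> exists C, forall x p, - C <= H x p.
Proof.
move=> hH; have [_ cH _] := hH; have [r r0 hr] := coercive_bound 0 cH.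
have [N hN] := hamiltonian_bounded hH (ltW r0); exists `|N| => x p.
have [hp|hp] := leP (H x p) 0.
  have := hN x p (hr _ _ hp); rewrite ler_norml => /andP[+ _].
  by apply: le_trans; rewrite lerN2 ler_norm.
by apply: le_trans (ltW hp); rewrite oppr_le0 normr_ge0.
Qed.

Lemma enorm_nbhs (R : realType) n (z : 'rV[R]_n) (P : set 'rV[R]_n) :
  (\forall x \near z, P x) -> exists2 e, 0 < e & forall x, enorm (x - z) < e -> P x.
Proof.
move=> /nbhs_ballP[e /= e0 he]; exists e => // x hx; apply: he.
rewrite -ball_normE /=; apply: le_lt_trans hx.
by rewrite enormB; exact: mx_norm_le_enorm.
Qed.

Lemma coercive_max (R : realType) n (f : 'rV[R]_n -> R) z rho :
  continuous f -> 0 <= rho -> (forall x, rho <= enorm (x - z) -> f x <= f z) ->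
  exists x0, forall x, f x <= f x0.
Proof.
move=> cf r0 h.
have A0 : [set x : 'rV[R]_n | enorm (x - z) <= rho] !=set0.
  by exists z; rewrite /= subrr enorm0.
have [_ [x0 [_ hm]]] := EVT_bool A0 (@compact_eball R n z rho) (fun _ : bool => cf).
have hz : f z <= f x0 by apply: (hm true); rewrite /= subrr enorm0.
exists x0 => x; have [hx|/ltW hx] := leP (enorm (x - z)) rho; first exact: (hm true).
exact: le_trans (h _ hx) hz.
Qed.

(* Touching [v] from above by paraboloids shows that the zeroth order part of
   the equation is bounded at a dense set of points. *)
Lemma cell_coupling_bound (R : realType) n (H : 'rV[R]_n -> 'rV[R]_n -> R) C P c (w v : 'rV[R]_n -> R) :
  (forall x p, - C <= H x p) -> continuous v -> continuous w -> Zperiodic v ->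
  visc_subsolution setT (cell_eq H P c w) v ->
  forall x, v x - w x <= c + C.
Proof.
move=> hC cv cw pv sv z; rewrite leNgt; apply/negP => hz.
have cvw : continuous (fun x => v x - w x) by cont.
have [e e0 he] := enorm_nbhs (near_gt cvw hz).
have [N hN] := periodic_bounded cv pv.
pose a := (`|N - v z| + 1) / e ^+ 2.
have e20 : 0 < e ^+ 2 by rewrite exprn_gt0.
have ae : a * e ^+ 2 = `|N - v z| + 1 by rewrite /a divfK// gt_eqF.
have a0 : 0 < a by rewrite divr_gt0// ltr_wpDl.
have hpsi := isC1_quad a z.
have cpsi := isC1_continuous hpsi.
pose f x := v x - a * dot (x - z) (x - z).
have cf : continuous f by apply: contD => //; exact: contN.
have fz : f z = v z by rewrite /f subrr dot0 mulr0 subr0.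
have out x : e <= enorm (x - z) -> f x < f z.
  move=> hx; rewrite fz /f -sqr_enorm.
  have : a * e ^+ 2 <= a * enorm (x - z) ^+ 2.
    by rewrite ler_pM2l// ler_pXn2r ?nnegrE ?enorm_ge0// ltW.
  have := hN x; have := ler_norm (N - v z); lra.
have [x0 hx0] := coercive_max cf (ltW e0) (fun x hx => ltW (out x hx)).
have x0e : enorm (x0 - z) < e.
  by rewrite ltNge; apply/negP => /out; have := hx0 z; lra.
have := cell_sub_test sv hpsi (z0 := x0).
have nx : \forall x \near x0, f x <= f x0 by apply: (@filterE _ (nbhs x0)).
move=> /(_ nx); have := he _ x0e; have := hC x0 (P + (2 * a) *: (x0 - z)); rewrite /=; lra.
Qed.

(** The equation and the bound on sublevels confine a test gradient at contact to length
    [r + enorm P], half of the slope of the cone used as test function. The smoothed cone is that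
    flat only within distance [s] of its vertex, so the contact point approaches the vertex as [s]
    shrinks. *)
Lemma gradient_bound_lipschitz (R : realType) n (H : 'rV[R]_n -> 'rV[R]_n -> R)
    P c (w v : 'rV[R]_n -> R) A r :
  0 < r -> (forall x p, H x p <= c + A -> enorm p <= r) ->
  (forall x, w x - v x <= A) -> continuous v -> Zperiodic v ->
  visc_subsolution setT (cell_eq H P c w) v ->
  forall x y, v x - v y <= 2 * (r + enorm P) * enorm (x - y).
Proof.
move=> r0 hr hA cv pv sv x z.
set M := 2 * _.
have P0 := enorm_ge0 P.
have M0 : 0 < M by rewrite /M; lra.
have [N hN] := periodic_bounded cv pv.
apply/ler_addgt0Pr => e e0; rewrite leNgt; apply/negP => hx.
have e20 : v z < v z + e / 2 by rewrite ltrDl divr_gt0.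
have [d d0 hd] := enorm_nbhs (near_lt cv e20).
(* One half of [e] pays for the variation of [v] near the vertex, the other for the height [M * s]
   added by the smoothing. *)
pose s := Num.min (d / 2) (e / (2 * M)).
have s0 : 0 < s by rewrite lt_min !divr_gt0// mulr_gt0.
have sd : s <= d / 2 by rewrite ge_min lexx.
have sM : M * s <= e / 2.
  have : s <= e / (2 * M) by rewrite ge_min lexx orbT.
  rewrite -(ler_pM2l M0) (_ : M * (e / (2 * M)) = e / 2)//.
  by field; rewrite gt_eqF.
have hpsi : isC1 (fun x => M * ang s z x) (fun x v => dot (M *: dang s z x) v).
  have h0 := isC1Z M (isC1_ang z s0).
  apply: (isC1_eq h0) => [//|y u].
  by rewrite [RHS]dotZl.
have cpsi := isC1_continuous hpsi.
pose f x := v x - M * ang s z x.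
have cf : continuous f by apply: contD => //; exact: contN.
have rho0 : 0 <= `|N - v z| / M + s by rewrite addr_ge0 ?divr_ge0// ltW.
have out y : `|N - v z| / M + s <= enorm (y - z) -> f y <= f z.
  move=> hy; rewrite /f ang_center ?(ltW s0)//.
  have h1 : M * (`|N - v z| / M + s) <= M * ang s z y.
    by rewrite ler_pM2l//; apply: le_trans hy (ang_ge _ _ _).
  have h2 : M * (`|N - v z| / M + s) = `|N - v z| + M * s by field; rewrite gt_eqF.
  have := hN y; have := ler_norm (N - v z); lra.
have [x0 hx0] := coercive_max cf rho0 out.
have nx : \forall x \near x0, f x <= f x0 by apply: (@filterE _ (nbhs x0)).
have h := cell_sub_test sv hpsi nx.
have : enorm (P + M *: dang s z x0) <= r.
  by apply: hr; move: h; have := hA x0; rewrite /=; lra.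
move=> h1.
have h2 : M * enorm (dang s z x0) <= r + enorm P.
  rewrite -[M]gtr0_norm// -enormZ.
  have := enormD (P + M *: dang s z x0) (- P).
  by rewrite addrAC subrr add0r enormN; lra.
have h3 : enorm (dang s z x0) <= 1 / 2.
  rewrite -(ler_pM2l M0) (_ : M * (1 / 2) = r + enorm P)//; by rewrite /M; field.
have a0 := ang_gt0 z x0 s0.
have h4 : enorm (x0 - z) <= s.
  move: h3; rewrite enormZ gtr0_norm ?invr_gt0// ler_pdivrMl//.
  have := ang_le z x0 (ltW s0); lra.
have h5 : v x0 < v z + e / 2 by apply: hd; lra.
have h6 := hx0 x; move: h6; rewrite /f => h6.
have h7 := ang_le z x (ltW s0); rewrite -(ler_pM2l M0) in h7.
have h8 : 0 < M * ang s z x0 by rewrite mulr_gt0.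
lra.
Qed.

(** The coupling bound, for both components, feeds the gradient bound. Periodicity then bounds the
    oscillation of one component, and the coupling bound passes to the other. Only upper bounds on
    [enorm P] and [c] enter, whence the uniform [M]. *)
Lemma corrector_bounds (R : realType) n (H : bool -> 'rV[R]_n -> 'rV[R]_n -> R) :
  (forall b, hamiltonian (H b)) -> forall K c0, exists2 M, 0 < M &
  forall P c v, enorm P <= K -> c <= c0 ->
    (forall b, continuous (v b)) -> (forall b, Zperiodic (v b)) ->
    (forall b, visc_subsolution setT (cell_eq (H b) P c (v (~~ b))) (v b)) ->
    (forall b x y, v b x - v b y <= M * enorm (x - y)) /\
    (forall b b' x y, v b x - v b' y <= M).
Proof.
move=> hH K c0.
have [C hC] : exists C, forall b x p, - C <= H b x p.
  have [C1 h1] := hamiltonian_lower (hH true); have [C2 h2] := hamiltonian_lower (hH false).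
  exists (Num.max C1 C2) => -[] x p; [apply: le_trans (h1 x p)|apply: le_trans (h2 x p)].
    by rewrite lerN2 le_max lexx.
  by rewrite lerN2 le_max lexx orbT.
pose A := c0 + C.
have [r r0 hr] : exists2 r, 0 < r & forall b x p, H b x p <= c0 + A -> enorm p <= r.
  have [_ cc1 _] := hH true; have [_ cc2 _] := hH false.
  have [r1 r10 h1] := coercive_bound (c0 + A) cc1.
  have [r2 r20 h2] := coercive_bound (c0 + A) cc2.
  exists (Num.max r1 r2); first by rewrite lt_max r10.
  move=> [] x p hp; rewrite le_max; first by rewrite (h1 x p hp).
  by rewrite (h2 x p hp) orbT.
pose M1 := 2 * (r + `|K|); pose D := 2 * unit_diam R n.
have D0 : 0 <= D by rewrite mulr_ge0// sqrtr_ge0.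
have K0 : 0 <= `|K| := normr_ge0 K; have KK := ler_norm K.
have M10 : 0 < M1 by rewrite /M1; lra.
have MD : 0 <= M1 * D by rewrite mulr_ge0// ltW.
exists (M1 + M1 * D + `|A|); first by rewrite ltr_wpDr// ltr_wpDr.
move=> P c v hP hc cv pv sv.
have cpl b x : v b x - v (~~ b) x <= A.
  apply: le_trans (cell_coupling_bound (hC b) (cv b) (cv _) (pv b) (sv b) x) _.
  by rewrite lerD2r.
have lip b x y : v b x - v b y <= M1 * enorm (x - y).
  have := gradient_bound_lipschitz r0 (fun x p h => hr b x p
    (le_trans h _)) _ (cv b) (pv b) (sv b) x y.
  move=> /(_ A) h; apply: le_trans (h _ _) _.
  - by rewrite lerD2r.
  - by move=> y'; have := cpl (~~ b) y'; rewrite negbK.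
  - by rewrite ler_wpM2r ?enorm_ge0// /M1; lra.
have osc b x y : v b x - v b y <= M1 * D.
  have [k hk] := periodic_reduce x; have [k' hk'] := periodic_reduce y.
  rewrite -(pv b x k) -(pv b y k'); apply: le_trans (lip _ _ _) _.
  rewrite ler_pM2l//; apply: le_trans (enormD _ _) _; rewrite enormN /D; lra.
have A0 := ler_norm A; have A1 := normr_ge0 A.
split=> [b x y|b b' x y].
  apply: le_trans (lip b x y) _; rewrite ler_wpM2r ?enorm_ge0//; lra.
have h1 := osc b x y; have [->|bb'] := eqVneq b' b; first lra.
have -> : b' = ~~ b by move: bb'; case: b {h1}; case: b'.
have := cpl b y; lra.
Qed.

(** * Doubling of variables *)

Lemma gradient_lipschitz (R : realType) n (g : 'rV[R]_n -> R) gx L :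
  isC1 g (fun x v => dot (gx x) v) -> (forall x, enorm (gx x) <= L) ->
  forall x y, g x - g y <= L * enorm (x - y).
Proof.
move=> hg hL x y.
pose f := fun s : R => g (s *: (x - y) + y).
have df (s : R) : is_derive s 1 f (dot (gx (s *: (x - y) + y)) (x - y)).
  have hl : is_diff s (fun s : R => s *: (x - y) + y) (fun h => h *: (x - y) + 0).
    exact: is_diffD (is_diff_scalel s (x - y)) (is_diff_cst y s).
  have hf := is_diff_comp hl (hg.1 _).
  have d1 : differentiable f s by have [] := hf.
  split; first exact/derivable1_diffP.
  by rewrite deriveE//; have [_ ->] := hf; rewrite /= addr0 scale1r.
have cf : continuous f.
  have cg := isC1_continuous hg.
  rewrite /f; apply: (cont_comp cg); apply: contD; last by cont.
  by move=> z; exact: scalel_continuous.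
have [c _ hc] := @MVT R f (fun s => dot (gx (s *: (x - y) + y)) (x - y)) 0 1 ltr01
  (fun s _ => df s) (continuous_subspaceT cf).
move: hc; rewrite /f scale1r subrK scale0r add0r subr0 mulr1 => ->.
apply: le_trans (dot_le _ _) _; by rewrite ler_wpM2r ?enorm_ge0.
Qed.

Lemma dot_sqrD (R : realType) n (p q : 'rV[R]_n) :
  dot (p + q) (p + q) = dot p p + 2 * dot p q + dot q q.
Proof. by rewrite !(dotDl, dotDr) (dotC q p); ring. Qed.

Lemma ang_sym (R : realType) n s (a x : 'rV[R]_n) : ang s a x = ang s x a.
Proof. by rewrite /ang -!sqr_enorm enormB. Qed.

Lemma ang_lip (R : realType) n s (a x y : 'rV[R]_n) :
  ang s a x <= ang s a y + enorm (x - y).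
Proof.
have h0 := enorm_ge0 (x - y); have h1 : 0 <= ang s a y by exact: sqrtr_ge0.
rewrite -(ler_pXn2r (n := 2))// ?nnegrE ?sqrtr_ge0 ?addr_ge0//.
rewrite sqrrD !sqr_ang.
have -> : x - a = (y - a) + (x - y) by rewrite [RHS]addrC subrKA.
rewrite dot_sqrD -!sqr_enorm.
have h2 := dot_le (y - a) (x - y).
have h3 : enorm (y - a) * enorm (x - y) <= ang s a y * enorm (x - y).
  by rewrite ler_wpM2r// ang_ge.
lra.
Qed.

(* Concavity of the square root. *)
Lemma ang_taylor (R : realType) n s (a x y : 'rV[R]_n) : 0 < s ->
  ang s a x <= ang s a y + dot (dang s a y) (x - y) + enorm (x - y) ^+ 2 / (2 * s).
Proof.
move=> s0; set h := x - y.
have A0 := ang_gt0 a y s0; have As := ang_ge_s a y (ltW s0).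
set A := ang s a y in A0 As *.
have X0 : 0 <= ang s a x by exact: sqrtr_ge0.
set X := ang s a x in X0 *.
have E : X ^+ 2 = A ^+ 2 + 2 * dot (y - a) h + enorm h ^+ 2.
  rewrite !sqr_ang (_ : x - a = (y - a) + h); last by rewrite /h [RHS]addrC subrKA.
  by rewrite dot_sqrD -!sqr_enorm; ring.
have h1 : X <= A + (X ^+ 2 - A ^+ 2) / (2 * A).
  rewrite -subr_ge0 (_ : _ - _ = (X - A) ^+ 2 / (2 * A)).
    by rewrite divr_ge0 ?sqr_ge0// mulr_ge0// ltW.
  by field; rewrite gt_eqF.
have h2 : (X ^+ 2 - A ^+ 2) / (2 * A) = A^-1 * dot (y - a) h + enorm h ^+ 2 / (2 * A).
  by rewrite E; field; rewrite gt_eqF.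
have h3 : enorm h ^+ 2 / (2 * A) <= enorm h ^+ 2 / (2 * s).
  by rewrite ler_wpM2l ?sqr_ge0// lef_pV2 ?posrE ?mulr_gt0// ler_pM2l.
rewrite /dang dotZl -/A; lra.
Qed.

Lemma effective_super_test (R : realType) n (Hb : 'rV[R]_n -> R) T u f fx ft z0 :
  visc_supersolution (open_strip T) (effective_eq Hb) u -> isC1t f fx ft ->
  0 < z0.2 < T -> (\forall z \near z0, u z0 - f z0 <= u z - f z) ->
  0 <= ft z0 + Hb (fx z0).
Proof.
move=> h hf z0T /(h _ _ (isC1_C1_on hf) z0T).
by rewrite /effective_eq (time_derivE hf) (space_gradE hf).
Qed.

(* [M] is uniform in [P]; nothing relates the correctors at different [P]. *)
Definition has_correctors (R : realType) n (H : bool -> 'rV[R]_n -> 'rV[R]_n -> R)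
    (Hb : 'rV[R]_n -> R) (K M : R) :=
  forall P, enorm P <= K -> exists v : bool -> 'rV[R]_n -> R,
    [/\ forall b x y, v b x - v b y <= M * enorm (x - y),
        forall b b' x y, v b x - v b' y <= M
      & forall b, visc_supersolution setT (cell_eq (H b) P (Hb P) (v (~~ b))) (v b)].

Lemma isC1t_cone (R : realType) n (s : R) (x0 : 'rV[R]_n) (C t1 : R) : 0 < s ->
  isC1t (fun z : 'rV[R]_n * R => ang s x0 z.1 + C * (z.2 - t1))
    (fun z => dang s x0 z.1) (fun _ => C).
Proof.
move=> s0; have := isC1tD (isC1t_space (isC1_ang x0 s0)) (isC1t_time n C t1).
by move/isC1_eq; apply=> // z v; rewrite addr0 add0r.
Qed.

(* One step of length [tau] from a maximum point of the doubled functional: [p0]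
   and [q0] are the derivatives of the penalisation there. *)
Lemma one_step (R : realType) (n : nat) (H : bool -> 'rV[R]_n -> 'rV[R]_n -> R)
    (CH eps T tau M c a eta e1 : R) (p0 x0 : 'rV[R]_n) t0 b0
    (Z : bool -> 'rV[R]_n * R -> R) (v : bool -> 'rV[R]_n -> R) :
  0 < eps -> 0 < CH -> 0 < M -> 0 < tau -> tau <= t0 <= T -> 0 <= a -> 0 <= eta ->
  (forall b x p q, `|H b x p - H b x q| <= CH * enorm (p - q)) ->
  (forall b, unif_in_space (H b)) ->
  (forall b, continuous (Z b)) ->
  (forall b, visc_subsolution (open_strip T) (system_eq (H b) eps (Z (~~ b))) (Z b)) ->
  (forall b x y, v b x - v b y <= M * enorm (x - y)) ->
  (forall b b' x y, v b x - v b' y <= M) ->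
  (forall b, visc_supersolution setT (cell_eq (H b) p0 c (v (~~ b))) (v b)) ->
  (forall b x, Z b (x, t0 - tau) <= Z b0 (x0, t0) + dot p0 (x - x0)
     + a * enorm (x - x0) ^+ 2 + eta * enorm (x - x0) + e1) ->
  0 <= e1 + a * ((1 + CH) * tau) ^+ 2 + eta * ((1 + CH) * tau) - c * tau + eps * M.
Proof.
move=> eps0 CH0 M0 tau0 /andP[taut0 t0T] a0 eta0 Hl Hu cZ sZ lv ov sv init.
pose t1 := t0 - tau.
(* Smoothing the cone at scale [tau] makes its value at (x0, t0) equal to [(1 + CH) * tau],
   comparable to the distance travelled in one step. *)
pose S := fun z : 'rV[R]_n * R => ang tau x0 z.1 + CH * (z.2 - t1).
have hS : isC1t S (fun z => dang tau x0 z.1) (fun _ => CH) by exact: isC1t_cone.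
(* The oscillation bound [M] puts the test function above both components at time [t1]; at (x0, t0)
   the corrector value cancels and only [eps * M] is left. *)
pose C := Z b0 (x0, t0) + e1 + eps * (M - v b0 (eps^-1 *: x0)) - dot p0 x0.
pose l := fun z : 'rV[R]_n * R =>
  dot p0 z.1 + (a * (S z * S z) + eta * S z) + (- c) * (z.2 - t1) + C.
have hl : isC1t l (fun z => p0 + (2 * a * S z + eta) *: dang tau x0 z.1)
    (fun z => (2 * a * S z + eta) * CH - c).
  have h1 := isC1t_space (isC1_dot p0).
  have h2 := isC1D (isC1D (isC1D h1 (isC1D (isC1Z a (isC1M hS hS)) (isC1Z eta hS)))
    (isC1t_time n (- c) t1)) (isC1_cst _ C).
  apply: (isC1_eq h2) => [//|z w].
  by rewrite dotDl dotZl (dotC 0) dot0; ring.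
have S0 z : t1 <= z.2 -> 0 <= S z.
  move=> ht; rewrite addr_ge0 ?sqrtr_ge0// mulr_ge0 ?(ltW CH0)// subr_ge0//.
have lt1 z : t1 <= z.2 -> - c + CH * enorm (p0 + (2 * a * S z + eta) *: dang tau x0 z.1 - p0)
    <= (2 * a * S z + eta) * CH - c.
  move=> /S0 Sz; rewrite addrAC subrr add0r enormZ ger0_norm; last first.
    by rewrite addr_ge0// !mulr_ge0.
  rewrite addrC lerD2r mulrC ler_wpM2r ?(ltW CH0)//.
  rewrite -[leRHS]mulr1 ler_wpM2l ?enorm_dang// addr_ge0// !mulr_ge0//.
have t10 : 0 <= t1 by rewrite subr_ge0.
have hinit b x : Z b (x, t1) <= l (x, t1) + eps * v b (eps^-1 *: x).
  apply: (le_trans (init b x)); rewrite /l /S /= subrr !mulr0 !addr0 /C.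
  have h1 := ang_ge tau x0 x; have h0 := enorm_ge0 (x - x0).
  have h2 : enorm (x - x0) ^+ 2 <= ang tau x0 x * ang tau x0 x by rewrite expr2 ler_pM.
  have h3 : a * enorm (x - x0) ^+ 2 <= a * (ang tau x0 x * ang tau x0 x) by rewrite ler_wpM2l.
  have h4 : eta * enorm (x - x0) <= eta * ang tau x0 x by rewrite ler_wpM2l.
  have h5 : 0 <= eps * (M - v b0 (eps^-1 *: x0)) + eps * v b (eps^-1 *: x).
    rewrite -mulrDr mulr_ge0 ?(ltW eps0)//.
    have := ov b0 b (eps^-1 *: x0) (eps^-1 *: x); lra.
  rewrite dotDr dotNr; lra.
have t1t0 : t1 <= t0 <= T by rewrite t0T andbT /t1 gerBl ltW.
have := comparison eps0 CH0 t10 M0 Hl Hu cZ sZ lv sv hl lt1 hinit b0 x0 t1t0.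
rewrite /l /S /C /= ang_center ?(ltW tau0)// /t1.
have -> : t0 - (t0 - tau) = tau by ring.
have -> : (tau + CH * tau) = (1 + CH) * tau by ring.
lra.
Qed.

(** Here [d] is the cube root of eps and the step has length [d ^+ 2]. The first two terms of the
    bound force the maximum beyond time [d ^+ 2], [K * d] is the value of the smoothed distance on
    the diagonal, and [d * B * T] pays for the time slope that produces the contradiction. *)
Lemma doubling_lt (R : realType) (n : nat) (H : bool -> 'rV[R]_n -> 'rV[R]_n -> R)
    (Hb : 'rV[R]_n -> R) (CH T M L C1 K d B : R)
    (Z : bool -> 'rV[R]_n * R -> R) (u : 'rV[R]_n * R -> R) :
  0 < CH -> 0 < M -> 0 < d -> 0 <= L -> 0 <= C1 ->
  K = L + C1 + 1 -> B = K * (1 + CH) ^+ 2 / 2 + 1 / 2 + M + 1 ->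
  (forall b x p q, `|H b x p - H b x q| <= CH * enorm (p - q)) ->
  (forall b, unif_in_space (H b)) ->
  has_correctors H Hb K M ->
  (forall b, continuous (Z b)) -> continuous u ->
  (forall b, visc_subsolution (open_strip T) (system_eq (H b) (d ^+ 3) (Z (~~ b))) (Z b)) ->
  visc_supersolution (open_strip T) (effective_eq Hb) u ->
  (forall b x y t s, 0 <= t <= T -> 0 <= s <= T ->
     Z b (x, t) - u (y, s) <= L * enorm (x - y) + C1 * (t + s)) ->
  forall b x t, 0 <= t < T ->
  Z b (x, t) - u (x, t) <= 2 * C1 * d ^+ 2 + C1 ^+ 2 * d / 2 + K * d + d * B * T.
Proof.
move=> CH0 M0 d0 L0 C10 KE BE Hl Hu corr cZ cu sZ su Zu bs xs ts /andP[ts0 tsT].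
rewrite leNgt; apply/negP => viol.
pose kap := d * B; rewrite -/kap in viol.
have T0 : 0 < T by lra.
have K0 : 0 < K by lra.
have CH2 : 0 < (1 + CH) ^+ 2 by rewrite exprn_gt0//; lra.
have B0 : 0 < B.
  have : 0 < K * (1 + CH) ^+ 2 by rewrite mulr_gt0.
  lra.
have kap0 : 0 < kap by rewrite mulr_gt0.
pose th0 := 2 * C1 * d ^+ 2 + C1 ^+ 2 * d / 2.
have th00 : 0 <= th0.
  by rewrite /th0 addr_ge0 ?divr_ge0 ?mulr_ge0 ?sqr_ge0// ltW.
pose nu := Z bs (xs, ts) - u (xs, ts) - (th0 + K * d + kap * T).
have nu0 : 0 < nu by rewrite /nu /th0 subr_gt0.
have as0 : 0 < ang 1 0 xs by exact: ang_gt0.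
(* A weight in x that only provides compactness: it uses a quarter of the violation [nu] and adds at
   most d / 2 to the time slope. *)
have [eta [eta0 eta1 eta2]] : exists eta, [/\ 0 < eta, eta * (1 + CH) <= d / 2
    & eta * ang 1 0 xs <= nu / 4].
  have [|||x x0 [x1 x2 _]] := @small_factor R (2 * (1 + CH) / d) (4 * ang 1 0 xs / nu) 0.
  - by rewrite divr_ge0 ?mulr_ge0 ?(ltW d0)//; lra.
  - by rewrite divr_ge0 ?mulr_ge0 ?(ltW as0) ?(ltW nu0).
  - by [].
  exists x; split=> //.
    move: x1; rewrite mulrA ler_pdivrMr// mul1r; lra.
  by move: x2; rewrite mulrA ler_pdivrMr// mul1r; lra.
pose h := (T - ts) / 2.
have h0 : 0 < h by rewrite /h; lra.
have nu40 : 0 < nu / 4 by lra.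
have [k k0 [k1 k2]] := expR_steep (2 * C1 * T + 1) h0 nu40.
pose bar := fun s : R => expR (k * (s - (ts + h))).
have bar0 s : 0 < bar s by exact: expR_gt0.
pose pen := fun z : ('rV[R]_n * R) * ('rV[R]_n * R) =>
  K * ang d z.2.1 z.1.1 + (2 * d)^-1 * (z.1.2 - z.2.2) ^+ 2 + eta * ang 1 0 z.1.1
  + kap * z.1.2 + bar z.2.2.
pose Phi := fun b (z : ('rV[R]_n * R) * ('rV[R]_n * R)) => Z b z.1 - u z.2 - pen z.
have Phi_s : th0 < Phi bs ((xs, ts), (xs, ts)).
  rewrite /Phi /pen /= ang_center ?(ltW d0)// subrr expr0n mulr0 addr0.
  have : bar ts <= nu / 4.
    by apply: le_trans k1; rewrite /bar opprD addrA subrr add0r.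
  have : kap * ts <= kap * T by rewrite ler_pM2l// ltW.
  move: eta2 nu0; rewrite /nu; lra.
have up b x t y s : 0 <= t <= T -> 0 <= s <= T ->
    Phi b ((x, t), (y, s)) <= C1 * (t + s) - (C1 + 1) * enorm (x - y)
      - (2 * d)^-1 * (t - s) ^+ 2 - eta * enorm x - bar s.
  move=> tT sT; have := Zu b x y t s tT sT; rewrite /Phi /pen /=.
  have : K * enorm (x - y) <= K * ang d y x by rewrite ler_pM2l// ang_ge.
  have : eta * enorm x <= eta * ang 1 0 x.
    by rewrite ler_pM2l//; have := ang_ge 1 0 x; rewrite subr0.
  have : 0 <= kap * t by rewrite mulr_ge0 ?(ltW kap0)//; case/andP: tT.
  rewrite KE; lra.
have d2 : 0 < (2 * d)^-1 by rewrite invr_gt0; lra.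
have tsC t s : 0 <= t <= T -> 0 <= s <= T -> C1 * (t + s) <= 2 * C1 * T.
  move=> /andP[_ tT] /andP[_ sT].
  have : C1 * (t + s) <= C1 * (T + T) by rewrite ler_wpM2l//; lra.
  lra.
(* Beyond [R1] the weight in x beats the growth bound; beyond [R2], with x inside [R1], the excess
   of [K] over [L] does. *)
pose R1 := (2 * C1 * T + 1) / eta; pose R2 := R1 + 2 * C1 * T + 1.
have R1E : eta * R1 = 2 * C1 * T + 1 by rewrite /R1 mulrC divfK// gt_eqF.
have C1T : 0 <= 2 * C1 * T by rewrite !mulr_ge0// ltW.
have far1 b x t y s : 0 <= t <= T -> 0 <= s <= T -> R1 < enorm x -> Phi b ((x, t), (y, s)) < 0.
  move=> tT sT hx; apply: le_lt_trans (up b x t y s tT sT) _.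
  have := tsC t s tT sT.
  have : eta * R1 < eta * enorm x by rewrite ltr_pM2l.
  have : 0 <= (C1 + 1) * enorm (x - y) by rewrite mulr_ge0 ?enorm_ge0// addr_ge0.
  have : 0 <= (2 * d)^-1 * (t - s) ^+ 2 by rewrite mulr_ge0 ?sqr_ge0// ltW.
  have := bar0 s; rewrite R1E; clear; lra.
have far2 b x t y s : 0 <= t <= T -> 0 <= s <= T -> enorm x <= R1 -> R2 < enorm y ->
    Phi b ((x, t), (y, s)) < 0.
  move=> tT sT hx hy; apply: le_lt_trans (up b x t y s tT sT) _.
  have := tsC t s tT sT.
  have h1 : 2 * C1 * T + 1 <= enorm (x - y).
    have := enorm_tri x y 0; rewrite !subr0 (enormB y x); move: hx hy; rewrite /R2; clear; lra.
  have : 0 <= C1 * enorm (x - y) by rewrite mulr_ge0 ?enorm_ge0.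
  have : 0 <= (2 * d)^-1 * (t - s) ^+ 2 by rewrite mulr_ge0 ?sqr_ge0// ltW.
  have : 0 <= eta * enorm x by rewrite mulr_ge0 ?enorm_ge0// ltW.
  have := bar0 s; move: h1; clear; lra.
pose A := ([set x : 'rV[R]_n | enorm (x - 0) <= R1] `*` `[0, T]%classic) `*`
  ([set x : 'rV[R]_n | enorm (x - 0) <= R2] `*` `[0, T]%classic).
have AE x t y s : A ((x, t), (y, s)) <->
    [/\ enorm x <= R1, 0 <= t <= T, enorm y <= R2 & 0 <= s <= T].
  rewrite /A /setX /= !subr0 !in_itv /=.
  by split=> [[[? ?] [? ?]]|[? ? ? ?]].
have cA : compact A.
  by do !apply: compact_setX; first [exact: compact_eball|exact: segment_compact].
have tsI : 0 <= ts <= T by rewrite ts0 ltW.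
have As : A ((xs, ts), (xs, ts)).
  have h1 : enorm xs <= R1.
    rewrite leNgt; apply/negP => /(far1 bs xs ts xs ts tsI tsI); move: Phi_s th00; clear; lra.
  by apply/AE; split=> //; move: h1 C1T; rewrite /R2; clear; lra.
have cPhi b : continuous (Phi b).
  have cang (s : R) (f g : ('rV[R]_n * R) * ('rV[R]_n * R) -> 'rV[R]_n) :
      continuous f -> continuous g -> continuous (fun z => ang s (f z) (g z)).
    move=> cf cg; apply: (@cont_comp _ _ _ _ Num.sqrt); first exact: sqrt_continuous.
    by cont.
  have csq (f : ('rV[R]_n * R) * ('rV[R]_n * R) -> R) :
      continuous f -> continuous (fun z => f z ^+ 2).
    by move=> cf; apply: contM.
  rewrite /Phi /pen /bar.
  apply: contD; first by cont.
  apply: contN; apply: contD; last by cont.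
  apply: contD; last by cont.
  apply: contD; last by apply: contM; [cont|apply: cang; cont].
  by apply: contD; apply: contM; [cont|apply: cang; cont|cont|apply: csq; cont].
have [b0 [[[x0 t0] [y0 s0]] [/AE[Ax At Ay As0] hmaxA]]] := EVT_bool (ex_intro _ _ As) cA cPhi.
set Pm := Phi b0 _ in hmaxA.
have Pm0 : th0 < Pm by apply: lt_le_trans Phi_s (hmaxA bs _ As).
(* The maximum must be global in space, because [one_step] asks for an initial bound on all of
   space. *)
have hmax b x t y s : 0 <= t <= T -> 0 <= s <= T -> Phi b ((x, t), (y, s)) <= Pm.
  move=> tT sT; have [hx|hx] := leP (enorm x) R1; last first.
    by apply/ltW/(lt_trans (far1 b x t y s tT sT hx))/(le_lt_trans th00 Pm0).
  have [hy|hy] := leP (enorm y) R2; last by apply/ltW/(lt_trans (far2 b x t y s tT sT hx hy))/(le_lt_trans th00 Pm0).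
  exact/hmaxA/AE.
have up0 := up b0 x0 t0 y0 s0 At As0; rewrite -/Pm in up0.
have nn1 : 0 <= (C1 + 1) * enorm (x0 - y0) by rewrite mulr_ge0 ?enorm_ge0// addr_ge0.
have nn2 : 0 <= eta * enorm x0 by rewrite mulr_ge0 ?enorm_ge0// ltW.
have nn3 := bar0 s0.
have young : C1 * (s0 - t0) <= (2 * d)^-1 * (t0 - s0) ^+ 2 + C1 ^+ 2 * d / 2.
  have : 0 <= (2 * d)^-1 * (s0 - t0 - C1 * d) ^+ 2 by rewrite mulr_ge0 ?sqr_ge0// ltW.
  rewrite (_ : (2 * d)^-1 * (s0 - t0 - C1 * d) ^+ 2 =
    (2 * d)^-1 * (t0 - s0) ^+ 2 + C1 ^+ 2 * d / 2 - C1 * (s0 - t0)); [clear; lra|].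
  by field; rewrite gt_eqF.
(* Otherwise Young's inequality would keep the maximum below [th0]. Hence a full step back from [t0]
   stays in the strip. *)
have t0tau : d ^+ 2 < t0.
  rewrite ltNge; apply/negP => ht.
  have : C1 * t0 <= C1 * d ^+ 2 by rewrite ler_wpM2l.
  move: up0 Pm0 nn1 nn2 nn3 young; rewrite /th0; clear; lra.
have s00 : 0 < s0.
  have /andP[s0' _] := As0; rewrite lt_def s0' andbT; apply/eqP => e.
  have h1 := Zu b0 x0 y0 t0 s0 At As0.
  have young2 : C1 * t0 <= (2 * d)^-1 * (t0 - s0) ^+ 2 + C1 ^+ 2 * d / 2.
    have : 0 <= (2 * d)^-1 * (t0 - C1 * d) ^+ 2 by rewrite mulr_ge0 ?sqr_ge0// ltW.
    rewrite (_ : (2 * d)^-1 * (t0 - C1 * d) ^+ 2 =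
      (2 * d)^-1 * (t0 - s0) ^+ 2 + C1 ^+ 2 * d / 2 - C1 * t0); [clear; lra|].
    by rewrite e; field; rewrite gt_eqF.
  have : 0 <= 2 * C1 * d ^+ 2 by rewrite !mulr_ge0// ltW.
  have e' : C1 * (t0 + s0) = C1 * t0 by rewrite e addr0.
  move: up0 Pm0 nn1 nn2 nn3 young2; rewrite e' /th0; clear; lra.
have s0T : s0 < T.
  have /andP[_ s0'] := As0; rewrite lt_neqAle s0' andbT; apply/eqP => e.
  have : 2 * C1 * T + 1 <= bar s0.
    by apply: le_trans k2 _; rewrite /bar e /h ler_expR ler_pM2l//; clear; lra.
  have := tsC t0 s0 At As0.
  have : 0 <= (2 * d)^-1 * (t0 - s0) ^+ 2 by rewrite mulr_ge0 ?sqr_ge0// ltW.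
  move: up0 Pm0 nn1 nn2 th00; clear; lra.
pose p0 := K *: dang d y0 x0.
have dangE : dang d x0 y0 = - dang d y0 x0.
  by rewrite /dang ang_sym -scalerN opprB.
have p0K : enorm p0 <= K.
  by rewrite enormZ gtr0_norm// -[leRHS]mulr1 ler_pM2l// enorm_dang.
have [v [lv ov sv]] := corr p0 p0K.
(* The penalisation depends on x - y and t - s, so its derivatives in (y, s) are opposite to those
   in (x, t), apart from the auxiliary terms. The derivative of [bar] has the favourable sign and is
   dropped. *)
have sup : - ((t0 - s0) / d) <= Hb p0.
  have hC1 : isC1t (fun z : 'rV[R]_n * R => - K * ang d x0 z.1
      + (- (2 * d)^-1 * ((1 * (z.2 - t0)) * (1 * (z.2 - t0))) + (- 1) * expR (k * (z.2 - (ts + h)))))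
      (fun z => - K *: dang d x0 z.1)
      (fun z => - d^-1 * (z.2 - t0) - k * expR (k * (z.2 - (ts + h)))).
    have h1 := isC1Z (- K) (isC1_fst R (isC1_ang x0 d0)).
    have h2 := isC1_expR (isC1t_time n k (ts + h)).
    have h3 := isC1t_time n 1 t0.
    have h4 := isC1D h1 (isC1D (isC1Z (- (2 * d)^-1) (isC1M h3 h3)) (isC1Z (- 1) h2)).
    apply: (isC1_eq h4) => [//|z w].
    by rewrite [dot (- K *: _) _]dotZl (dotC 0) dot0; field; rewrite gt_eqF.
  have := effective_super_test (z0 := (y0, s0)) su hC1.
  rewrite /= s00 s0T dangE scaleNr scalerN opprK -/p0 => /(_ isT) sup.
  suff : 0 <= - d^-1 * (s0 - t0) - k * expR (k * (s0 - (ts + h))) + Hb p0.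
    have : 0 <= k * expR (k * (s0 - (ts + h))) by rewrite mulr_ge0 ?expR_ge0// ltW.
    by rewrite (_ : (t0 - s0) / d = - d^-1 * (s0 - t0)); [clear; lra|ring].
  apply: sup.
  have n2 := @near_lt R _ (fun z : 'rV[R]_n * R => z.2) T (y0, s0) ltac:(cont) s0T.
  have n3 := @near_gt R _ (fun z : 'rV[R]_n * R => z.2) 0 (y0, s0) ltac:(cont) s00.
  apply: filterS2 n2 n3 => -[y s] /= hs1 hs2.
  have sT : 0 <= s <= T by apply/andP; split; exact: ltW.
  have := hmax b0 x0 t0 y s At sT; rewrite /Pm /Phi /pen /= /bar !(ang_sym d _ x0) !mul1r; clear; lra.
pose q0 := (t0 - s0) / d.
have t0I : d ^+ 2 <= t0 <= T by rewrite (ltW t0tau); case/andP: At.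
pose a := K / (2 * d).
have a0 : 0 <= a by rewrite divr_ge0 ?mulr_ge0// ltW.
have := @one_step R n H CH (d ^+ 3) T (d ^+ 2) M (Hb p0) a eta
  (- q0 * d ^+ 2 + (2 * d)^-1 * (d ^+ 2) ^+ 2 - kap * d ^+ 2) p0 x0 t0 b0 Z v
  (exprn_gt0 3 d0) CH0 M0 (exprn_gt0 2 d0) t0I a0 (ltW eta0) Hl Hu cZ sZ lv ov sv.
(* Maximality with (y0, s0) kept fixed. [ang_taylor] produces the coefficient [a], and expanding the
   time penalty produces the slope [q0]. *)
have init b x : Z b (x, t0 - d ^+ 2) <= Z b0 (x0, t0) + dot p0 (x - x0)
     + a * enorm (x - x0) ^+ 2 + eta * enorm (x - x0)
     + (- q0 * d ^+ 2 + (2 * d)^-1 * (d ^+ 2) ^+ 2 - kap * d ^+ 2).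
  have tI : 0 <= t0 - d ^+ 2 <= T.
    apply/andP; split; first by rewrite subr_ge0 ltW.
    have : 0 < d ^+ 2 by rewrite exprn_gt0.
    by case/andP: At => _; clear; lra.
  have := hmax b x (t0 - d ^+ 2) y0 s0 tI As0; rewrite /Pm /Phi /pen /=.
  have h1 : K * ang d y0 x <= K * ang d y0 x0 + dot p0 (x - x0) + a * enorm (x - x0) ^+ 2.
    have := ang_taylor y0 x x0 d0; rewrite -(ler_pM2l K0) /p0 dotZl /a; clear; lra.
  have h2 : eta * ang 1 0 x <= eta * ang 1 0 x0 + eta * enorm (x - x0).
    by rewrite -mulrDr ler_pM2l// ang_lip.
  have h3 : (2 * d)^-1 * (t0 - d ^+ 2 - s0) ^+ 2 = (2 * d)^-1 * (t0 - s0) ^+ 2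
      - q0 * d ^+ 2 + (2 * d)^-1 * (d ^+ 2) ^+ 2.
    by rewrite /q0; field; rewrite gt_eqF.
  move: h1 h2; rewrite h3; clear; lra.
move=> /(_ init) fin.
have d20 : 0 < d ^+ 2 by rewrite exprn_gt0.
have e1 : (2 * d)^-1 * (d ^+ 2) ^+ 2 = d ^+ 2 * (d / 2) by field; rewrite gt_eqF.
have e2 : a * ((1 + CH) * d ^+ 2) ^+ 2 = d ^+ 2 * (d * (K * (1 + CH) ^+ 2 / 2)).
  by rewrite /a; field; rewrite gt_eqF.
have e3 : eta * ((1 + CH) * d ^+ 2) = d ^+ 2 * (eta * (1 + CH)) by ring.
have e4 : d ^+ 3 * M = d ^+ 2 * (d * M) by ring.
(* After division by the step length every error is of order [d]. The last 1 in [B] absorbs the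
   [eta] term and leaves d / 2 for strictness. *)
have fin2 : 0 <= d ^+ 2 * (- q0 - Hb p0 + d / 2 - kap + d * (K * (1 + CH) ^+ 2 / 2)
    + eta * (1 + CH) + d * M).
  by move: fin; rewrite e1 e2 e3 e4; clear; lra.
rewrite pmulr_rge0// in fin2; move: fin2 sup eta1 d0; rewrite /kap BE -/q0; clear; lra.
Qed.

(** * Sign change and locality of viscosity inequalities *)

Lemma C1_on_is_diff (R : realType) (V : normedModType R) (O : set V) (f : V -> R)
    (df : V -> V -> R) : open O -> (forall z, O z -> is_diff z f (df z)) ->
  (forall z v, O z -> {for z, continuous (fun w => df w v)}) ->
  C1_on O f /\ (forall z v, O z -> 'D_v f z = df z v).
Proof.
move=> oO h c.
have D z v : O z -> 'D_v f z = df z v.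
  by move=> /h [d e]; rewrite deriveE// e.
split=> // z Oz; split; first by have [] := h z Oz.
move=> v; rewrite /prop_for /continuous_at D//.
apply: cvg_trans (c z v Oz); apply: near_eq_cvg.
by apply: filterS (open_nbhs_nbhs (conj oO Oz)) => w Ow; rewrite D.
Qed.

Lemma C1_on_add_isC1 (R : realType) (V : normedModType R) (O : set V) (f g : V -> R) dg :
  open O -> C1_on O f -> isC1 g dg ->
  C1_on O (fun z => f z + g z) /\
  (forall z v, O z -> 'D_v (fun z => f z + g z) z = 'D_v f z + dg z v).
Proof.
move=> oO hf [hg cg]; apply: C1_on_is_diff => // z.
  move=> Oz; have [d _] := hf z Oz.
  have df : is_diff z f (fun v => 'D_v f z).
    by split=> //; apply/funext => v; rewrite deriveE.
  exact: (is_diffD df (hg z)).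
move=> v Oz; have [_ c] := hf z Oz.
by apply: continuousD; [exact: c|exact: cg].
Qed.

Lemma C1_on_opp (R : realType) (V : normedModType R) (O : set V) (f : V -> R) :
  open O -> C1_on O f ->
  C1_on O (fun z => - f z) /\ (forall z v, O z -> 'D_v (fun z => - f z) z = - 'D_v f z).
Proof.
move=> oO hf; apply: C1_on_is_diff => // z.
  move=> Oz; have [d _] := hf z Oz.
  have df : is_diff z f (fun v => 'D_v f z).
    by split=> //; apply/funext => v; rewrite deriveE.
  exact: (is_diffN df).
move=> v Oz; have [_ c] := hf z Oz.
by apply: continuousN; exact: c.
Qed.

Lemma visc_sub_opp (R : realType) (V : normedModType R) (O : set V)
    (F F' : V -> R -> (V -> R) -> R) (u : V -> R) : open O ->
  (forall z d, F' z (- u z) d = - F z (u z) (fun v => - d v)) ->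
  visc_supersolution O F u -> visc_subsolution O F' (fun z => - u z).
Proof.
move=> oO hF hu phi z0 hphi Oz hmax; have [c1 D] := C1_on_opp oO hphi.
rewrite hF oppr_le0.
have -> : (fun v => - 'D_v phi z0) = fun v => 'D_v (fun z => - phi z) z0.
  by apply/funext => v; rewrite D.
by apply: hu => //; apply: filterS hmax => z; lra.
Qed.

Lemma visc_super_opp (R : realType) (V : normedModType R) (O : set V)
    (F F' : V -> R -> (V -> R) -> R) (u : V -> R) : open O ->
  (forall z d, F' z (- u z) d = - F z (u z) (fun v => - d v)) ->
  visc_subsolution O F u -> visc_supersolution O F' (fun z => - u z).
Proof.
move=> oO hF hu phi z0 hphi Oz hmax; have [c1 D] := C1_on_opp oO hphi.
rewrite hF oppr_ge0.
have -> : (fun v => - 'D_v phi z0) = fun v => 'D_v (fun z => - phi z) z0.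
  by apply/funext => v; rewrite D.
by apply: hu => //; apply: filterS hmax => z; lra.
Qed.

Lemma visc_sub_congr (R : realType) (V : normedModType R) (O : set V)
    (F F' : V -> R -> (V -> R) -> R) (u u' : V -> R) : open O ->
  (forall z, O z -> u' z = u z) -> (forall z d, O z -> F' z (u z) d = F z (u z) d) ->
  visc_subsolution O F u -> visc_subsolution O F' u'.
Proof.
move=> oO hu hF sub phi z0 hphi Oz hmax; rewrite hu// hF//; apply: sub => //.
apply: filterS2 (open_nbhs_nbhs (conj oO Oz)) hmax => z Oz'.
by rewrite !hu.
Qed.

Lemma visc_super_congr (R : realType) (V : normedModType R) (O : set V)
    (F F' : V -> R -> (V -> R) -> R) (u u' : V -> R) : open O ->
  (forall z, O z -> u' z = u z) -> (forall z d, O z -> F' z (u z) d = F z (u z) d) ->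
  visc_supersolution O F u -> visc_supersolution O F' u'.
Proof.
move=> oO hu hF sub phi z0 hphi Oz hmax; rewrite hu// hF//; apply: sub => //.
apply: filterS2 (open_nbhs_nbhs (conj oO Oz)) hmax => z Oz'.
by rewrite !hu.
Qed.

Lemma open_strip_open (R : realType) n (T : R) : open (@open_strip R n T).
Proof.
rewrite openE => z /andP[z0 zT].
have c : continuous (fun z : 'rV[R]_n * R => z.2) by cont.
by apply: filterS2 (near_gt c z0) (near_lt c zT) => w w0 wT; apply/andP.
Qed.

(** * The effective Hamiltonian and uniform correctors *)

Definition solvable_cell (R : realType) n (H : bool -> 'rV[R]_n -> 'rV[R]_n -> R)
    (Hb : 'rV[R]_n -> R) :=
  forall P, exists v : bool -> 'rV[R]_n -> R,
  [/\ forall b, continuous (v b), forall b, Zperiodic (v b) &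
      forall b, visc_solution setT (cell_eq (H b) P (Hb P) (v (~~ b))) (v b)].

(** Long-time comparison with eps = 1: the profile of slope [P] moves in time at rate [- Hb P],
    while the corrector for [Q], tilted by [P], gives a supersolution at rate
    [- Hb Q + CH * enorm (P - Q)]. If the second rate were smaller, the profiles would cross; [T] is
    a time by which the excess [e] has outgrown the initial gap. *)
Lemma effective_lipschitz (R : realType) n (H : bool -> 'rV[R]_n -> 'rV[R]_n -> R)
    (Hb : 'rV[R]_n -> R) (CH : R) :
  0 < CH -> (forall b, hamiltonian (H b)) ->
  (forall b x p q, `|H b x p - H b x q| <= CH * enorm (p - q)) ->
  solvable_cell H Hb -> forall P Q, Hb Q - Hb P <= CH * enorm (P - Q).
Proof.
move=> CH0 hH Hl cell P Q.
have [M M0 hM] := corrector_bounds hH (Num.max (enorm P) (enorm Q)) (Num.max (Hb P) (Hb Q)).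
have [v [cv pv sv]] := cell P; have [w [cw pw sw]] := cell Q.
have [_ ov] := hM P (Hb P) v ltac:(by rewrite le_max lexx) ltac:(by rewrite le_max lexx)
  cv pv (fun b => (sv b).1).
have [lw ow] := hM Q (Hb Q) w ltac:(by rewrite le_max lexx orbT)
  ltac:(by rewrite le_max lexx orbT) cw pw (fun b => (sw b).1).
rewrite leNgt; apply/negP => viol.
pose e := Hb Q - Hb P - CH * enorm (P - Q).
have e0 : 0 < e by rewrite subr_gt0.
pose C0 := 2 * M + v true 0 - w true 0.
pose T := (`|C0 + w true 0 - v true 0| + 1) / e.
have eT : e * T = `|C0 + w true 0 - v true 0| + 1.
  by rewrite /T mulrC divfK// gt_eqF.
have T0 : 0 < T by rewrite divr_gt0// ltr_wpDl.
pose Z := fun b (z : 'rV[R]_n * R) => dot P z.1 + v b z.1 - Hb P * z.2.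
have cZ b : continuous (Z b).
  by rewrite /Z; have := cv b => cvb; cont.
have sZ b : visc_subsolution (open_strip T) (system_eq (H b) 1 (Z (~~ b))) (Z b).
  exact: cell_to_system (sv b).1.
pose K := - Hb Q + CH * enorm (P - Q).
have hl := isC1D (isC1D (isC1t_space (isC1_dot P)) (isC1t_time n K 0)) (isC1_cst _ C0).
have {}hl : isC1t (fun z : 'rV[R]_n * R => dot P z.1 + K * (z.2 - 0) + C0)
    (fun _ => P) (fun _ => K).
  by apply: (isC1_eq hl) => // z x; rewrite (dotC 0) dot0; ring.
have := @comparison R n H CH 1 T 0 M (Hb Q) Q Z w _ _ _ ltr01 CH0 (lexx _) M0 Hl
  (fun b => hamiltonian_unif (hH b)) cZ sZ lw (fun b => (sw b).2) hl.
move=> /(_ (fun z _ => lexx _)) h.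
have /h /(_ true 0 T) : forall b x, Z b (x, 0) <= dot P x + K * (0 - 0) + C0 + 1 * w b (1^-1 *: x).
  move=> b x; rewrite /Z /C0 /= subrr !mulr0 invr1 scale1r.
  have := ov b true x 0; have := ow true b 0 x; lra.
rewrite (ltW T0) lexx => /(_ isT); rewrite /Z /= scaler0 dot0.
have := ler_norm (C0 + w true 0 - v true 0).
rewrite /K; rewrite /e in eT; lra.
Qed.

(** The Lipschitz bound on [Hb] supplies the common upper bound on the constants [Hb P] that
    [corrector_bounds] asks for. *)
Lemma correctors_exist (R : realType) n (H : bool -> 'rV[R]_n -> 'rV[R]_n -> R)
    (Hb : 'rV[R]_n -> R) (CH K : R) :
  0 < CH -> (forall b, hamiltonian (H b)) ->
  (forall P Q, Hb Q - Hb P <= CH * enorm (P - Q)) ->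
  solvable_cell H Hb -> exists2 M, 0 < M &
  forall P, enorm P <= K -> exists v : bool -> 'rV[R]_n -> R,
    [/\ forall b x y, v b x - v b y <= M * enorm (x - y),
        forall b b' x y, v b x - v b' y <= M
      & forall b, visc_solution setT (cell_eq (H b) P (Hb P) (v (~~ b))) (v b)].
Proof.
move=> CH0 hH lip cell.
have [M M0 hM] := corrector_bounds hH K (Hb 0 + CH * K).
exists M => // P PK; have [v [cv pv sv]] := cell P.
have hP : Hb P <= Hb 0 + CH * K.
  have := lip 0 P; rewrite sub0r enormN.
  have : CH * enorm P <= CH * K by rewrite ler_pM2l.
  lra.
have [l o] := hM P (Hb P) v PK hP cv pv (fun b => (sv b).1).
by exists v.
Qed.

(** * The rate for a common initial datum *)

Lemma cube_root (R : realType) (e : R) : 0 < e ->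
  0 < e `^ (1 / 3) /\ (e `^ (1 / 3)) ^+ 3 = e.
Proof.
move=> e0; split; first exact: powR_gt0.
rewrite -powR_mulrn ?powR_ge0// -powRrM.
by rewrite (_ : 1 / 3 * 3%:R = 1) ?powRr1 ?(ltW e0)//; field.
Qed.

Lemma upper_rate (R : realType) (n : nat) (H : bool -> 'rV[R]_n -> 'rV[R]_n -> R)
    (Hb : 'rV[R]_n -> R) (CH T L c0 : R) (g : 'rV[R]_n -> R) gx :
  0 < CH -> 0 < T ->
  (forall b x p q, `|H b x p - H b x q| <= CH * enorm (p - q)) ->
  (forall b, unif_in_space (H b)) ->
  (forall b x, - c0 <= H b x 0) ->
  (forall p q, `|Hb p - Hb q| <= CH * enorm (p - q)) ->
  (forall K, exists2 M, 0 < M & has_correctors H Hb K M) ->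
  isC1 g (fun x v => dot (gx x) v) -> (forall x, enorm (gx x) <= L) ->
  exists2 C, 0 < C & forall eps, 0 < eps -> forall Z u,
    (forall b, continuous (Z b)) -> continuous u ->
    (forall b, visc_subsolution (open_strip T) (system_eq (H b) eps (Z (~~ b))) (Z b)) ->
    visc_supersolution (open_strip T) (effective_eq Hb) u ->
    (forall b x, Z b (x, 0) <= g x) -> (forall x, g x <= u (x, 0)) ->
    forall b x t, 0 <= t <= T -> Z b (x, t) - u (x, t) <= C * eps `^ (1 / 3).
Proof.
move=> CH0 T0 Hl Hu Hc Hbl corr hg hL.
have L0 : 0 <= L by apply: le_trans (hL 0); exact: enorm_ge0.
have CL : 0 <= CH * L by rewrite mulr_ge0// ltW.
pose C1 := `|c0| + `|Hb 0| + CH * L.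
have C10 : 0 <= C1 by rewrite /C1 !addr_ge0.
pose K := L + C1 + 1; have [M M0 hM] := corr K.
pose B := K * (1 + CH) ^+ 2 / 2 + 1 / 2 + M + 1.
have K0 : 0 < K by rewrite /K; lra.
have B0 : 0 < B.
  have : 0 <= K * (1 + CH) ^+ 2 by rewrite mulr_ge0 ?sqr_ge0// ltW.
  rewrite /B; lra.
have BT : 0 < B * T by rewrite mulr_gt0.
have C1T : 0 <= C1 * T by rewrite mulr_ge0// ltW.
have C12 : 0 <= C1 ^+ 2 by exact: sqr_ge0.
pose C := 2 * C1 + C1 ^+ 2 / 2 + K + B * T + 2 * (C1 * T).
have C_gt0 : 0 < C by rewrite /C; lra.
exists C => // eps eps0 Z u cZ cu sZ su iZ iu.
have gZ b x t : 0 <= t <= T -> Z b (x, t) <= g x + C1 * t.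
  move=> tT; apply: le_trans (growth eps0 CH0 Hl Hu Hc cZ sZ hg hL iZ b x tT) _.
  rewrite lerD2l ler_wpM2r//; first by case/andP: tT.
  by have := ler_norm c0; have := normr_ge0 (Hb 0); rewrite /C1; lra.
have gu x t : 0 <= t <= T -> - u (x, t) <= - g x + C1 * t.
  move=> tT.
  (* Two equal copies of [- u] form a system whose coupling vanishes, so [growth] with eps = 1
     bounds [u] from below. *)
  pose H' := fun (_ : bool) (_ p : 'rV[R]_n) => - Hb (- p).
  have Hl' b y p q : `|H' b y p - H' b y q| <= CH * enorm (p - q).
    rewrite /H' (_ : - Hb (- p) - - Hb (- q) = Hb (- q) - Hb (- p)); last by ring.
    by apply: le_trans (Hbl _ _) _; rewrite opprK addrC.
  have Hu' b : unif_in_space (H' b).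
    by move=> K' e e0; exists 1 => // y y' p _ _; rewrite /H' subrr.
  have Hc' b y : - `|Hb 0| <= H' b y 0 by rewrite /H' oppr0 lerN2 ler_norm.
  have su' (b : bool) : visc_subsolution (open_strip T)
      (system_eq (H' b) 1 (fun z => - u z)) (fun z => - u z).
    apply: (visc_sub_opp (@open_strip_open R n T) _ su) => z d.
    rewrite /system_eq /effective_eq /H' subrr mulr0 addr0 /time_deriv opprD opprK.
    by congr (_ - Hb _); apply/rowP => i; rewrite !mxE.
  have hg' : isC1 (fun y => - g y) (fun y v => dot (- gx y) v).
    have h := isC1Z (-1) hg; apply: (isC1_eq h) => [|y v]; last by rewrite dotNl mulN1r.
    by apply/funext => y; rewrite mulN1r.
  have hL' y : enorm (- gx y) <= L by rewrite enormN.
  have cu' : forall _ : bool, continuous (fun z => - u z) by move=> _; cont.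
  have iu' (_ : bool) y : - u (y, 0) <= - g y by rewrite lerN2.
  apply: le_trans (growth ltr01 CH0 Hl' Hu' Hc' cu' su' hg' hL' iu' true x tT) _.
  rewrite lerD2l ler_wpM2r//; first by case/andP: tT.
  by have := normr_ge0 c0; rewrite /C1; lra.
have [d0 dE] := cube_root eps0; set d := eps `^ (1 / 3) in d0 dE *.
have Zu b x y t s : 0 <= t <= T -> 0 <= s <= T ->
    Z b (x, t) - u (y, s) <= L * enorm (x - y) + C1 * (t + s).
  move=> tT sT; have := gZ b x t tT; have := gu y s sT.
  have := gradient_lipschitz hg hL x y; lra.
move=> b x t tT.
(* For eps above 1 the growth bounds alone have the required size. *)
have [d1|d1] := leP d 1; last first.
  have := Zu b x x t t tT tT; rewrite subrr enorm0 mulr0 add0r => /le_trans; apply.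
  have : C1 * (t + t) <= C1 * (T + T) by rewrite ler_wpM2l//; case/andP: tT; lra.
  have : C * 1 <= C * d by rewrite ler_pM2l// ltW.
  rewrite mulr1 /C; lra.
have dd : d ^+ 2 <= d by rewrite expr2 ler_piMr// ltW.
have bound t' : 0 <= t' < T -> Z b (x, t') - u (x, t') <= C * d.
  move=> tT'; rewrite -dE in sZ.
  have := doubling_lt CH0 M0 d0 L0 C10 erefl erefl Hl Hu hM cZ cu sZ su Zu b x tT'.
  rewrite -/K -/B => /le_trans; apply.
  have : C1 * d ^+ 2 <= C1 * d by rewrite ler_wpM2l.
  have : 0 <= (C1 * T) * d by rewrite mulr_ge0// ltW.
  rewrite /C; lra.
move: tT => /andP[t0]; rewrite le_eqVlt => /predU1P[->|tT]; last by apply: bound; rewrite t0.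
rewrite -subr_le0.
have cZb := cZ b.
apply: (@le_at_endpoint R (fun t => Z b (x, t) - u (x, t) - C * d) 0) => //.
- exact: ltW.
- by cont.
- by move=> s sT; rewrite subr_le0 bound.
- by rewrite subr_le0 bound// lexx.
Qed.

(** * Initial layer *)

(** Solutions are continuous only on the closed strip. Composing with this retraction makes them
    continuous everywhere and leaves them unchanged on the strip. *)
Definition clamp (R : realType) (n : nat) (T : R) (z : 'rV[R]_n * R) : 'rV[R]_n * R :=
  (z.1, Num.max 0 (Num.min z.2 T)).

Lemma clamp_strip (R : realType) n (T : R) (z : 'rV[R]_n * R) :
  0 <= T -> closed_strip T (clamp T z).
Proof.
by move=> T0; rewrite /closed_strip /= le_max lexx ge_max T0 ge_min lexx orbT.
Qed.

Lemma clamp_id (R : realType) n (T : R) (z : 'rV[R]_n * R) :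
  closed_strip T z -> clamp T z = z.
Proof.
case: z => x t /andP[/= t0 tT]; rewrite /clamp /=.
by rewrite (min_idPl tT) (max_idPr t0).
Qed.

Lemma continuous_clamp (R : realType) n (T : R) (f : 'rV[R]_n * R -> R) :
  0 <= T -> {within closed_strip T, continuous f} -> continuous (fun z => f (clamp T z)).
Proof.
move=> T0 /subspace_continuousP cf z U hU.
have cc : continuous (@clamp R n T).
  have c1 : continuous (fun z : 'rV[R]_n * R => z.1) by cont.
  have c2 : continuous (fun z : 'rV[R]_n * R => z.2) by cont.
  apply: (cont_pair c1) => y.
  apply: (@continuous_max R _ (fun _ => 0) (fun z => Num.min z.2 T)); first exact: cst_continuous.
  by apply: (@continuous_min R _ (fun z => z.2) (fun _ => T)); [exact: c2|exact: cst_continuous].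
have h := cf _ (clamp_strip z T0) U hU.
have := near_comp cc erefl h; apply: filterS => y /=; apply; exact: clamp_strip.
Qed.

Lemma initial_datumP (R : realType) n (f : 'rV[R]_n -> R) : initial_datum f ->
  isC1 f (fun x v => dot (grad f x) v) /\ exists L, forall x, enorm (grad f x) <= L.
Proof.
move=> [hf hsup]; split.
  apply: isC1_eq (C1_on_isC1 hf) _ _ => // x v.
  have [d _] := hf x I.
  rewrite deriveE// [in LHS](row_sum_delta v) linear_sum /=.
  by apply: eq_bigr => i _; rewrite linearZ /= mxE deriveE// mulrC.
set S := sup_norm _ _ in hsup.
exists (fine S) => x.
have h : ((enorm (grad f x))%:E <= S)%E.
  by apply: ereal_sup_ubound; exists x => //; rewrite ger0_norm ?enorm_ge0.
rewrite -lee_fin fineK// fin_numElt hsup andbT.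
by apply: lt_le_trans h; rewrite ltNyr.
Qed.

(** Adding [k] to a test function for the difference gives one for [U]; the displayed inequality
    bounds the operator for the difference by the one for [U]. *)
Lemma system_sub_shift (R : realType) n (H : 'rV[R]_n -> 'rV[R]_n -> R) (eps T : R)
    (U W k k' : 'rV[R]_n * R -> R) kx kt :
  isC1t k kx kt ->
  (forall z p, open_strip T z -> H (eps^-1 *: z.1) p + eps^-1 * (k' z - k z)
     <= kt z + H (eps^-1 *: z.1) (p + kx z)) ->
  visc_subsolution (open_strip T) (system_eq H eps W) U ->
  visc_subsolution (open_strip T) (system_eq H eps (fun z => W z - k' z))
    (fun z => U z - k z).
Proof.
move=> hk hH hU phi z0 hphi z0T hmax.
have [c1 D] := C1_on_add_isC1 (@open_strip_open R n T) hphi hk.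
have := hU _ z0 c1 z0T; rewrite /system_eq /time_deriv D//= dot0 add0r mulr1.
have -> : space_grad (fun v => 'D_v (fun z => phi z + k z) z0) =
    space_grad (fun v => 'D_v phi z0) + kx z0.
  by apply/rowP => i; rewrite !mxE D//= mulr0 addr0 dot_delta.
have hm : \forall z \near z0, U z - (phi z + k z) <= U z0 - (phi z0 + k z0).
  by apply: filterS hmax => z; lra.
move=> /(_ hm); have := hH z0 (space_grad (fun v => 'D_v phi z0)) z0T; lra.
Qed.

Lemma layered_upper_rate (R : realType) (n : nat) (H : bool -> 'rV[R]_n -> 'rV[R]_n -> R)
    (Hb : 'rV[R]_n -> R) (CH T L c0 : R) (f : bool -> 'rV[R]_n -> R) fx :
  0 < CH -> 0 < T ->
  (forall b x p q, `|H b x p - H b x q| <= CH * enorm (p - q)) ->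
  (forall b, unif_in_space (H b)) ->
  (forall b x, - c0 <= H b x 0) ->
  (forall p q, `|Hb p - Hb q| <= CH * enorm (p - q)) ->
  (forall K, exists2 M, 0 < M & has_correctors H Hb K M) ->
  (forall b, isC1 (f b) (fun x v => dot (fx b x) v)) -> (forall b x, enorm (fx b x) <= L) ->
  exists2 C, 0 < C & forall eps, 0 < eps -> forall U u,
    (forall b, continuous (U b)) -> continuous u ->
    (forall b, visc_subsolution (open_strip T) (system_eq (H b) eps (U (~~ b))) (U b)) ->
    visc_supersolution (open_strip T) (effective_eq Hb) u ->
    (forall b x, U b (x, 0) = f b x) -> (forall x, u (x, 0) = (f true x + f false x) / 2) ->
    forall b x t, 0 <= t <= T ->
      U b (x, t) - m_eps u (f b) (f (~~ b)) eps (x, t) <= C * eps `^ (1 / 3).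
Proof.
move=> CH0 T0 Hl Hu Hc Hbl corr hf hL.
have L0 : 0 <= L by apply: le_trans (hL true 0); exact: enorm_ge0.
have hg := isC1Z 2^-1 (isC1D (hf true) (hf false)).
have {}hg : isC1 (fun x => (f true x + f false x) / 2)
    (fun x v => dot (2^-1 *: (fx true x + fx false x)) v).
  apply: (isC1_eq hg) => [|x v]; last by rewrite dotZl dotDl.
  by apply/funext => x; rewrite mulrC.
have hgL x : enorm (2^-1 *: (fx true x + fx false x)) <= L.
  rewrite enormZ gtr0_norm ?invr_gt0// ler_pdivrMl//.
  have := enormD (fx true x) (fx false x); have := hL true x; have := hL false x; lra.
have [C C0 hC] := upper_rate CH0 T0 Hl Hu Hc Hbl corr hg hgL.
have CL : 0 <= CH * L by rewrite mulr_ge0// ltW.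
have CLT : 0 <= CH * L * T by rewrite mulr_ge0// ltW.
exists (C + CH * L + CH * L * T); first by rewrite -addrA ltr_wpDr// addr_ge0.
move=> eps eps0 U u cU cu sU su iU iu.
(* The time derivative of [A * (1 - E)] is [CH * L * E], which is exactly the bound on [CH] times
   the length of the layer gradient [kx]. *)
pose A := CH * L * eps / 2.
pose E := fun z : 'rV[R]_n * R => expR (- 2 / eps * (z.2 - 0)).
have hE : isC1t E (fun _ => 0) (fun z => E z * (- 2 / eps)).
  have h := isC1_expR (isC1t_time n (- 2 / eps) 0).
  by apply: (isC1_eq h) => [//|z v]; rewrite (dotC 0) dot0 /E; ring.
pose k := fun b (z : 'rV[R]_n * R) =>
  2^-1 * (f b z.1 + (-1) * f (~~ b) z.1) * E z + A * (1 + (-1) * E z).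
pose kx := fun b (z : 'rV[R]_n * R) => (E z / 2) *: (fx b z.1 - fx (~~ b) z.1).
pose kt := fun b (z : 'rV[R]_n * R) =>
  (2^-1 * (f b z.1 - f (~~ b) z.1) - A) * (E z * (- 2 / eps)).
have hk b : isC1t (k b) (kx b) (kt b).
  have h1 := isC1Z 2^-1 (isC1D (isC1_fst R (hf b)) (isC1Z (-1) (isC1_fst R (hf (~~ b))))).
  have h2 := isC1Z A (isC1D (isC1_cst _ 1) (isC1Z (-1) hE)).
  have h := isC1D (isC1M h1 hE) h2.
  apply: (isC1_eq h) => [//|z v].
  by rewrite /kx /kt dotZl dotDl dotNl (dotC 0) dot0; ring.
have E0 z : 0 < E z by exact: expR_gt0.
pose Z := fun b z => U b z - k b z.
have sZ b : visc_subsolution (open_strip T) (system_eq (H b) eps (Z (~~ b))) (Z b).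
  apply: (system_sub_shift (hk b) _ (sU b)) => z p zT.
  have h := le_trans (ler_norm _) (Hl b (eps^-1 *: z.1) p (p + kx b z)).
  have h2 : CH * enorm (p - (p + kx b z)) <= CH * (E z * L).
    rewrite ler_pM2l// opprD addrA subrr add0r enormN enormZ gtr0_norm ?divr_gt0//.
    have := enormD (fx b z.1) (- fx (~~ b) z.1); rewrite enormN.
    have := hL b z.1; have := hL (~~ b) z.1 => a1 a2 a3.
    rewrite -mulrA ler_pM2l// ler_pdivrMl//; lra.
  have e1 : eps^-1 * (k (~~ b) z - k b z) = kt b z - CH * (E z * L).
    by rewrite /k /kt /A negbK; field; rewrite gt_eqF.
  rewrite e1; lra.
have cZ b : continuous (Z b).
  by have := cU b => cUb; have := isC1_continuous (hk b) => ckb; rewrite /Z; cont.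
have E00 (x : 'rV[R]_n) : E (x, 0) = 1 by rewrite /E /= subrr mulr0 expR0.
have iZ b x : Z b (x, 0) <= (f true x + f false x) / 2.
  rewrite /Z iU /k /= E00; case: b => /=; lra.
have iu' x : (f true x + f false x) / 2 <= u (x, 0) by rewrite iu.
move=> b x t tT.
have := hC eps eps0 Z u cZ cu sZ su iZ iu' b x t tT.
have [d0 dE] := cube_root eps0; set d := eps `^ (1 / 3) in d0 dE *.
have -> : m_eps u (f b) (f (~~ b)) eps (x, t) = u (x, t) + k b (x, t) - A * (1 - E (x, t)).
  rewrite /m_eps /k /E /= subr0 (_ : - 2 * t / eps = - 2 / eps * t); last by ring.
  by ring.
(* [1 - E] is at most 1 and at most 2 t / eps; the first bound serves for eps at most 1, the second
   for larger eps. *)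
have AE : A * (1 - E (x, t)) <= CH * L * d + CH * L * T * d.
  have A0 : 0 <= A by rewrite /A divr_ge0// mulr_ge0// ltW.
  have n1 : 0 <= CH * L * d by rewrite mulr_ge0// ltW.
  have n2 : 0 <= CH * L * T * d by rewrite mulr_ge0// ltW.
  have [d1|d1] := leP d 1.
    have ed : eps <= d.
      rewrite -dE exprS -[leRHS]mulr1 ler_pM2l// expr2.
      by apply: le_trans (_ : d * 1 <= _); [rewrite ler_pM2l|rewrite mulr1].
    have : A * (1 - E (x, t)) <= A * 1 by rewrite ler_wpM2l//; have := E0 (x, t); lra.
    have : CH * L * eps <= CH * L * d by rewrite ler_wpM2l.
    have : 0 <= CH * L * eps by rewrite mulr_ge0// ltW.
    rewrite /A; lra.
  have h1 : 1 - E (x, t) <= 2 / eps * t.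
    have := expR_ge1Dx (- 2 / eps * (t - 0)); rewrite /E /= subr0.
    by rewrite (_ : - 2 / eps * t = - (2 / eps * t)); [lra|ring].
  have h2 : A * (1 - E (x, t)) <= A * (2 / eps * t) by rewrite ler_wpM2l.
  have h3 : A * (2 / eps * t) = CH * L * t by rewrite /A; field; rewrite gt_eqF.
  have h4 : CH * L * t <= CH * L * T by rewrite ler_wpM2l//; case/andP: tT.
  have h5 : CH * L * T * 1 <= CH * L * T * d by rewrite ler_wpM2l// ltW.
  lra.
rewrite /Z; lra.
Qed.

(** * Reflection and the two-sided estimate *)

Definition hat (R : realType) (n : nat) (H : 'rV[R]_n -> 'rV[R]_n -> R) x p := - H x (- p).

Lemma space_grad_opp (R : realType) n (d : 'rV[R]_n * R -> R) :
  space_grad (fun v => - d v) = - space_grad d.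
Proof. by apply/rowP => i; rewrite !mxE. Qed.

Lemma two_sided_rate (R : realType) (n : nat) (H : bool -> 'rV[R]_n -> 'rV[R]_n -> R)
    (Hb : 'rV[R]_n -> R) (CH T : R) (f : bool -> 'rV[R]_n -> R) :
  0 < CH -> 0 < T -> (forall b, hamiltonian (H b)) ->
  (forall b x p q, `|H b x p - H b x q| <= CH * enorm (p - q)) ->
  solvable_cell H Hb -> (forall b, initial_datum (f b)) ->
  exists2 C, 0 < C & forall eps, 0 < eps -> forall U u,
    (forall b, continuous (U b)) -> continuous u ->
    (forall b, visc_solution (open_strip T) (system_eq (H b) eps (U (~~ b))) (U b)) ->
    visc_solution (open_strip T) (effective_eq Hb) u ->
    (forall b x, U b (x, 0) = f b x) -> (forall x, u (x, 0) = (f true x + f false x) / 2) ->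
    forall b x t, 0 <= t <= T ->
      `|U b (x, t) - m_eps u (f b) (f (~~ b)) eps (x, t)| <= C * eps `^ (1 / 3).
Proof.
move=> CH0 T0 hH Hl cell hf.
have lipb := effective_lipschitz CH0 hH Hl cell.
have Hbl p q : `|Hb p - Hb q| <= CH * enorm (p - q).
  by rewrite ler_norml lerNl opprB lipb enormB lipb.
have [N hN] : exists N, forall b x, `|H b x 0| <= N.
  have [N1 h1] := hamiltonian_bounded (hH true) (lexx 0).
  have [N2 h2] := hamiltonian_bounded (hH false) (lexx 0).
  have e0 : enorm (0 : 'rV[R]_n) <= 0 by rewrite enorm0.
  exists (Num.max N1 N2) => -[] x; [apply: le_trans (h1 x 0 e0) _|apply: le_trans (h2 x 0 e0) _].
    by rewrite le_max lexx.
  by rewrite le_max lexx orbT.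
have [L hL] : exists L, forall b x, enorm (grad (f b) x) <= L.
  have [_ [L1 h1]] := initial_datumP (hf true).
  have [_ [L2 h2]] := initial_datumP (hf false).
  exists (Num.max L1 L2) => -[] x; [apply: le_trans (h1 x) _|apply: le_trans (h2 x) _].
    by rewrite le_max lexx.
  by rewrite le_max lexx orbT.
have hC1 b := (initial_datumP (hf b)).1.
have uH b := hamiltonian_unif (hH b).
have corr K := correctors_exist K CH0 hH lipb cell.
have [C1 C10 hU] : exists2 C, 0 < C & forall eps, 0 < eps -> forall U u,
    (forall b, continuous (U b)) -> continuous u ->
    (forall b, visc_subsolution (open_strip T) (system_eq (H b) eps (U (~~ b))) (U b)) ->
    visc_supersolution (open_strip T) (effective_eq Hb) u ->
    (forall b x, U b (x, 0) = f b x) -> (forall x, u (x, 0) = (f true x + f false x) / 2) ->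
    forall b x t, 0 <= t <= T ->
      U b (x, t) - m_eps u (f b) (f (~~ b)) eps (x, t) <= C * eps `^ (1 / 3).
  apply: (layered_upper_rate CH0 T0 Hl uH (c0 := N) _ Hbl _ hC1 hL).
    by move=> b x; have := hN b x; rewrite ler_norml => /andP[].
  move=> K; have [M M0 hM] := corr K; exists M => // P PK.
  by have [v [l o s]] := hM P PK; exists v; split=> // b; have [] := s b.
have [C2 C20 hV] : exists2 C, 0 < C & forall eps, 0 < eps -> forall U u,
    (forall b, continuous (U b)) -> continuous u ->
    (forall b, visc_subsolution (open_strip T) (system_eq (hat (H b)) eps (U (~~ b))) (U b)) ->
    visc_supersolution (open_strip T) (effective_eq (fun p => - Hb (- p))) u ->
    (forall b x, U b (x, 0) = - f b x) -> (forall x, u (x, 0) = (- f true x + - f false x) / 2) ->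
    forall b x t, 0 <= t <= T ->
      U b (x, t) - m_eps u (fun x => - f b x) (fun x => - f (~~ b) x) eps (x, t)
        <= C * eps `^ (1 / 3).
  apply: (layered_upper_rate (H := fun b => hat (H b)) (f := fun b x => - f b x)
    (fx := fun b x => - grad (f b) x) (L := L) (c0 := N) CH0 T0).
  - move=> b x p q; rewrite /hat opprK addrC.
    by apply: le_trans (Hl _ _ _ _) _; rewrite opprK addrC.
  - move=> b K e e0; have [d d0 hd] := uH b K e e0; exists d => // x y p xy pK.
    by rewrite /hat opprK addrC; apply: hd; rewrite ?enormN// enormB.
  - by move=> b x; rewrite /hat oppr0 lerN2; have := hN b x; rewrite ler_norml => /andP[].
  - move=> p q; rewrite opprK addrC.
    by apply: le_trans (Hbl _ _) _; rewrite opprK addrC.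
  (* Correctors of the reflected problem at [P] are minus those at [- P]; here their subsolution
     property is used. The reflected Hamiltonians are not coercive, so correctors cannot be
     constructed for them directly. *)
  - move=> K; have [M M0 hM] := corr K; exists M => // P PK.
    have [|v [l o s]] := hM (- P); first by rewrite enormN.
    exists (fun b x => - v b x); split.
    + by move=> b x y; rewrite opprK addrC enormB.
    + by move=> b b' x y; rewrite opprK addrC.
    move=> b; apply: (visc_super_opp openT _ (s b).1) => z d.
    rewrite /cell_eq /hat (_ : - (P + _) = - P + \row_i (- d (delta_mx 0 i))); first by ring.
    by apply/rowP => i; rewrite !mxE opprD.
  - move=> b; have h := isC1Z (-1) (hC1 b).
    apply: (isC1_eq h) => [|x v]; last by rewrite dotNl mulN1r.
    by apply/funext => x; rewrite mulN1r.
  - by move=> b x; rewrite enormN.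
exists (Num.max C1 C2); first by rewrite lt_max C10.
move=> eps eps0 U u cU cu sU su iU iu b x t tT.
have e0 : 0 <= eps `^ (1 / 3) by exact: powR_ge0.
have up := hU eps eps0 U u cU cu (fun b => (sU b).1) su.2 iU iu b x t tT.
have lo : m_eps u (f b) (f (~~ b)) eps (x, t) - U b (x, t) <= C2 * eps `^ (1 / 3).
  have h := hV eps eps0 (fun b z => - U b z) (fun z => - u z).
  have := h (fun b => contN (cU b)) (contN cu) => {}h.
  have {}h := h (fun b => visc_sub_opp (@open_strip_open R n T) _ (sU b).2).
  have e1 b' (z : 'rV[R]_n * R) d : system_eq (hat (H b')) eps (fun z => - U (~~ b') z) z (- U b' z) d =
      - system_eq (H b') eps (U (~~ b')) z (U b' z) (fun v => - d v).
    by rewrite /system_eq /hat space_grad_opp /time_deriv; ring.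
  have e2 (z : 'rV[R]_n * R) d : effective_eq (fun p => - Hb (- p)) z (- u z) d =
      - effective_eq Hb z (u z) (fun v => - d v).
    by rewrite /effective_eq space_grad_opp /time_deriv; ring.
  have {}h := h (fun b => e1 b) (visc_super_opp (@open_strip_open R n T) e2 su.1).
  have {}h := h (fun b x => congr1 -%R (iU b x)).
  have {}h := h ltac:(by move=> y; rewrite iu; ring).
  apply: le_trans (h b x t tT); rewrite /m_eps /= le_eqVlt; apply/orP; left; apply/eqP; ring.
have m1 : C1 * eps `^ (1 / 3) <= Num.max C1 C2 * eps `^ (1 / 3).
  by rewrite ler_wpM2r// le_max lexx.
have m2 : C2 * eps `^ (1 / 3) <= Num.max C1 C2 * eps `^ (1 / 3).
  by rewrite ler_wpM2r// le_max lexx orbT.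
by rewrite ler_norml; apply/andP; split; lra.
Qed.

Theorem theorem1p3 (R : realType) (n : nat) (n_gt0 : (0 < n)%N)
    (H1 H2 : 'rV[R]_n -> 'rV[R]_n -> R)
    (hH1 : hamiltonian H1) (hH2 : hamiltonian H2)
    (f1 f2 : 'rV[R]_n -> R)
    (hf1 : initial_datum f1) (hf2 : initial_datum f2)
    (Hbar : 'rV[R]_n -> R) (hHbar : effective_hamiltonian H1 H2 Hbar)
    (C_H : R) (C_H_gt0 : 0 < C_H)
    (H1_lip : forall xi p q, `|H1 xi p - H1 xi q| <= C_H * enorm (p - q))
    (H2_lip : forall xi p q, `|H2 xi p - H2 xi q| <= C_H * enorm (p - q)) :
  forall T : R, 0 < T ->
  exists C : R, 0 < C /\
    forall eps : R, 0 < eps ->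
    forall u1 u2 u : 'rV[R]_n * R -> R,
      solves_system H1 H2 f1 f2 T eps u1 u2 ->
      solves_effective Hbar f1 f2 T u ->
      (sup_norm (closed_strip T) (fun z => u1 z - m_eps u f1 f2 eps z)%R
         <= (C * eps `^ (1 / 3))%R%:E)%E /\
      (sup_norm (closed_strip T) (fun z => u2 z - m_eps u f2 f1 eps z)%R
         <= (C * eps `^ (1 / 3))%R%:E)%E.
Proof.
move=> T T0.
pose H b := if b then H1 else H2.
pose f b := if b then f1 else f2.
have hH b : hamiltonian (H b) by case: b; [exact: hH1|exact: hH2].
have hf b : initial_datum (f b) by case: b; [exact: hf1|exact: hf2].
have Hl b x p q : `|H b x p - H b x q| <= C_H * enorm (p - q) by case: b; rewrite /H.
have cell : solvable_cell H Hbar.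
  move=> P; have [v1 [v2 [[c1 c2] [p1 p2] s1 s2]]] := (hHbar P (Hbar P)).2 erefl.
  by exists (fun b => if b then v1 else v2); split; case.
have [C C0 hC] := two_sided_rate C_H_gt0 T0 hH Hl cell hf.
exists C; split=> // eps eps0 u1 u2 u [[c1 c2] s1 s2 i12] [cu su iu].
have T0' := ltW T0.
(* The hypotheses say nothing off the closed strip. The clamped copies agree with the solutions on
   it, and locality gives them the same viscosity inequalities inside. *)
pose U b z := (if b then u1 else u2) (clamp T z).
have id_open (z : 'rV[R]_n * R) : open_strip T z -> clamp T z = z.
  by move=> /andP[z0 zT]; apply: clamp_id; rewrite /closed_strip /= !ltW.
have id0 (x : 'rV[R]_n) : clamp T (x, 0) = (x, 0).
  by apply: clamp_id; rewrite /closed_strip /= lexx.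
have cU b : continuous (U b) by case: b; exact: continuous_clamp.
have cu' : continuous (fun z => u (clamp T z)) by exact: continuous_clamp.
have oS := @open_strip_open R n T.
have Uo b z : open_strip T z -> U b z = (if b then u1 else u2) z.
  by move=> /id_open zE; rewrite /U zE.
have sU b : visc_solution (open_strip T) (system_eq (H b) eps (U (~~ b))) (U b).
  by case: b; split; [apply: (visc_sub_congr oS (Uo true) _ s1.1)
    |apply: (visc_super_congr oS (Uo true) _ s1.2)
    |apply: (visc_sub_congr oS (Uo false) _ s2.1)
    |apply: (visc_super_congr oS (Uo false) _ s2.2)] => z d Oz;
    rewrite /system_eq (Uo _ z Oz).
have su' : visc_solution (open_strip T) (effective_eq Hbar) (fun z => u (clamp T z)).
  have [s s'] := su; split.
    by apply: (visc_sub_congr oS _ _ s) => // z Oz; rewrite id_open.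
  by apply: (visc_super_congr oS _ _ s') => // z Oz; rewrite id_open.
have iU b x : U b (x, 0) = f b x by rewrite /U id0; have [] := i12 x; case: b.
have iu' x : u (clamp T (x, 0)) = (f true x + f false x) / 2 by rewrite id0 iu.
have main b x t : 0 <= t <= T -> `|(if b then u1 else u2) (x, t)
    - m_eps u (f b) (f (~~ b)) eps (x, t)| <= C * eps `^ (1 / 3).
  move=> tT; have := hC eps eps0 U _ cU cu' sU su' iU iu' b x t tT.
  by rewrite /U /m_eps clamp_id.
by split; apply: ge_ereal_sup => _ [[x t] tT <-]; rewrite lee_fin;
  [exact: (main true)|exact: (main false)].
Qed.
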